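(* Any finite point set $P\subseteq\mathbb{R}^d$ admits a general sparse spanner oracle with Steiner points $\mathcal{O}_{P,1+\epsilon}$ of weak sparsity $\mathtt{Ws}_{\mathcal{O}_{P,1+\epsilon}}=\tilde{O}_{\epsilon}(\epsilon^{-(d-1)/2})$.
   Context: Here $d=O(1)$ (constants may depend on $d$), and $\|x,y\|$ denotes Euclidean distance. A general sparse spanner oracle with Steiner points for $P$ with stretch $1+\epsilon$, denoted $\mathcal{O}_{P,1+\epsilon}$, is a polynomial-time algorithm that, given a subset $T\subseteq P$ and a distance parameter $L>0$, outputs a geometric graph $S=(V_S,E_S)$ (edges weighted by Euclidean length) with $T\subseteq V_S\subseteq\mathbb{R}^d$ such that $d_S(x,y)\leq(1+\epsilon)\|x,y\|$ for all $x\neq y$ in $T$ with $\|x,y\|\in[L,2L]$. Its weak sparsity is $\sup_{T\subseteq P,L>0}\frac{w(\mathcal{O}_{P,1+\epsilon}(T,L))}{|T|L}$, where $w(\cdot)$ is total edge weight. $\tilde{O}_\epsilon(\cdot)$ hides polylogarithmic factors of $1/\epsilon$. *)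

(* Defs.v *)
From HB Require Import structures.
From mathcomp Require Import all_boot all_order all_algebra finmap.
From mathcomp Require Import all_classical all_reals all_analysis.

Set Implicit Arguments.
Unset Strict Implicit.
Unset Printing Implicit Defensive.

Import Order.TTheory GRing.Theory Num.Theory.
Local Open Scope ring_scope.

(** * Geometric graphs in R^d *)

(* The library norm on row vectors is the sup norm, hence this definition. *)
Definition edist (R : realType) (d : nat) (x y : 'rV[R]_d) : R :=
  Num.sqrt (\sum_(i < d) (x ord0 i - y ord0 i) ^+ 2).

Record geom_graph (R : realType) (d : nat) := GeomGraph {
  gverts : {fset 'rV[R]_d};
  gadj : rel 'rV[R]_d;
  gadj_sym : symmetric gadj;
  gadj_irr : irreflexive gadj;
  gadj_verts : forall u v, gadj u v -> (u \in gverts) && (v \in gverts)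
}.

(* Every edge occurs twice in the double sum, as (u, v) and as (v, u). *)
Definition gweight (R : realType) (d : nat) (S : geom_graph R d) : R :=
  (\sum_(u <- gverts S) \sum_(v <- gverts S | gadj S u v) edist u v) / 2.

Definition walk_length (R : realType) (d : nat) (x : 'rV[R]_d)
    (p : seq 'rV[R]_d) : R :=
  \sum_(l <- pairmap (@edist R d) x p) l.

(* +oo when x and y are not connected. *)
Definition gdist (R : realType) (d : nat) (S : geom_graph R d)
    (x y : 'rV[R]_d) : \bar R :=
  ereal_inf [set (walk_length x p)%:E |
    p in [set p | x \in gverts S /\ path (gadj S) x p /\ last x p = y]]%classic.

(** * A real RAM

    While-programs over two unbounded memories, one of natural numbers and one
    of reals, with indirect addressing, exact real arithmetic and comparisons.
    As usual for the real RAM, there is no rounding from reals to integers, and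
    integers are only added and subtracted, so that their bit length grows by O(t)
    in t steps. Each assignment, output and test has unit cost: it evaluates
    an expression whose size is fixed by the program. Division by 0 gives 0. *)

Inductive nexp :=
  | NLit of nat
  | NGet of nexp
  | NAdd of nexp & nexp
  | NSub of nexp & nexp.

Inductive rexp :=
  | RLit of nat
  | ROfNat of nexp
  | RGet of nexp
  | RAdd of rexp & rexp
  | RSub of rexp & rexp
  | RMul of rexp & rexp
  | RDiv of rexp & rexp.

Inductive bexp :=
  | BNLt of nexp & nexp
  | BRLt of rexp & rexp
  | BNot of bexp
  | BAnd of bexp & bexp.

Inductive cmd :=
  | Skip
  | NSet of nexp & nexp
  | RSet of nexp & rexp
  | NOut of nexp
  | ROut of rexp
  | Seq of cmd & cmd
  | If of bexp & cmd & cmd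
  | While of bexp & cmd.

Record state (R : realType) := State {
  nmem : nat -> nat;
  rmem : nat -> R;
  nout : seq nat;
  rout : seq R
}.

Section Semantics.
Variable R : realType.
Implicit Types s : state R.

Fixpoint neval s (e : nexp) : nat :=
  match e with
  | NLit n => n
  | NGet a => nmem s (neval s a)
  | NAdd a b => (neval s a + neval s b)%N
  | NSub a b => (neval s a - neval s b)%N
  end.

Fixpoint reval s (e : rexp) : R :=
  match e with
  | RLit n => n%:R
  | ROfNat a => (neval s a)%:R
  | RGet a => rmem s (neval s a)
  | RAdd a b => reval s a + reval s b
  | RSub a b => reval s a - reval s b
  | RMul a b => reval s a * reval s b
  | RDiv a b => reval s a / reval s b
  end.

Fixpoint beval s (e : bexp) : bool :=
  match e with
  | BNLt a b => (neval s a < neval s b)%N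
  | BRLt a b => reval s a < reval s b
  | BNot a => ~~ beval s a
  | BAnd a b => beval s a && beval s b
  end.

Definition upd (T : Type) (m : nat -> T) (a : nat) (x : T) : nat -> T :=
  fun i => if i == a then x else m i.

(* exec c s t s' : started in s, the program c halts in s' after t steps. *)
Inductive exec : cmd -> state R -> nat -> state R -> Prop :=
  | exec_skip s : exec Skip s 1 s
  | exec_nset a e s : exec (NSet a e) s 1
      (State (upd (nmem s) (neval s a) (neval s e)) (rmem s) (nout s) (rout s))
  | exec_rset a e s : exec (RSet a e) s 1
      (State (nmem s) (upd (rmem s) (neval s a) (reval s e)) (nout s) (rout s))
  | exec_nout e s : exec (NOut e) s 1
      (State (nmem s) (rmem s) (rcons (nout s) (neval s e)) (rout s))
  | exec_rout e s : exec (ROut e) s 1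
      (State (nmem s) (rmem s) (nout s) (rcons (rout s) (reval s e)))
  | exec_seq c1 c2 s1 s2 s3 t1 t2 :
      exec c1 s1 t1 s2 -> exec c2 s2 t2 s3 ->
      exec (Seq c1 c2) s1 (t1 + t2)%N s3
  | exec_if b c1 c2 s t s' :
      exec (if beval s b then c1 else c2) s t s' ->
      exec (If b c1 c2) s t.+1 s'
  | exec_while_end b c s : ~~ beval s b -> exec (While b c) s 1 s
  | exec_while_step b c s1 s2 s3 t1 t2 :
      beval s1 b -> exec c s1 t1 s2 -> exec (While b c) s2 t2 s3 ->
      exec (While b c) s1 (t1 + t2).+1 s3.

End Semantics.

(** * Spanner oracles *)

Definition coords (R : realType) (d : nat) (x : 'rV[R]_d) : seq R :=
  [seq x ord0 i | i <- enum 'I_d].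

(* An oracle O_{P,1+eps} is one program run with P and eps as parameters, on
   the query (T, L): the integer memory starts with |T|, |P| and the real
   memory with eps, L, the points of T, the points of P; the rest is 0. *)
Definition init_state (R : realType) (d : nat) (eps : R) (P T : seq 'rV[R]_d)
    (L : R) : state R :=
  State (nth 0%N [:: size T; size P])
        (nth 0 ([:: eps; L] ++ flatten [seq coords x | x <- T]
                            ++ flatten [seq coords x | x <- P]))
        [::] [::].

(* The real output lists the vertices and the integer output lists the edges,
   as pairs of positions in the vertex list. Repetitions are harmless: vertices
   are points, so that equal points are the same vertex; loops are discarded. *)
Definition outputs_graph (R : realType) (d : nat) (s : state R)
    (S : geom_graph R d) : Prop :=
  exists (vs : seq 'rV[R]_d) (es : seq (nat * nat)),
    [/\ rout s = flatten [seq coords x | x <- vs],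
        nout s = flatten [seq [:: e.1; e.2] | e <- es],
        all (fun e => (e.1 < size vs)%N && (e.2 < size vs)%N) es,
        gverts S =i vs
      & forall u v : 'rV[R]_d, gadj S u v = (u != v) &&
          has (fun e => ((u, v) == (nth 0 vs e.1, nth 0 vs e.2))
                     || ((v, u) == (nth 0 vs e.1, nth 0 vs e.2))) es].

(* Finite point sets are presented as duplicate-free lists: the output of an
   algorithm may depend on the order in which its input is listed. *)
Definition oracle (R : realType) (d : nat) : Type :=
  seq 'rV[R]_d -> R -> geom_graph R d.

Definition query (R : realType) (d : nat) (P T : seq 'rV[R]_d) (L : R) : Prop :=
  [/\ uniq T, {subset T <= P} & 0 < L].

(* A answers every query to O_{P,1+eps} in time polynomial in |T| and 1/eps. *)
Definition computes_oracle (R : realType) (d : nat) (A : cmd) (a b : nat)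
    (eps : R) (P : seq 'rV[R]_d) (O : oracle R d) : Prop :=
  forall T L, query P T L ->
    exists t s, [/\ exec A (init_state eps P T L) t s,
                    t%:R <= a%:R * ((size T)%:R + eps^-1) ^+ b
                  & outputs_graph s (O T L)].

Definition spanner_oracle (R : realType) (d : nat) (eps : R)
    (P : seq 'rV[R]_d) (O : oracle R d) : Prop :=
  forall T L, query P T L ->
    {subset T <= gverts (O T L)} /\
    (forall x y, x \in T -> y \in T -> x != y -> L <= edist x y <= 2 * L ->
       (gdist (O T L) x y <= ((1 + eps) * edist x y)%:E)%E).

(* The empty T is left out, as its ratio is undefined. *)
Definition weak_sparsity (R : realType) (d : nat) (P : seq 'rV[R]_d)
    (O : oracle R d) : \bar R :=
  ereal_sup [set r : \bar R | exists T L, [/\ query P T L, T != [::]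
    & r = (gweight (O T L) / ((size T)%:R * L))%:E]]%classic.

(* Main.v *)
(* Take L = 1. Each point x is within sup-distance 1 of a center of a greedily
   chosen net, and only 6^d centers lie within distance 3 of x, since distinct
   centers occupy distinct unit cells. Around every center c and for each axis i,
   place Steiner points on the hyperplanes orthogonal to axis i at levels
   3d times per unit, with spacing 1/(3dm) inside the hyperplanes, where
   m = ceil(eps^(-1/2)); this is O(eps^(-(d-1)/2)) points. Join each x to the
   Steiner points of the centers within distance 3 of x.

   If L <= |xy| <= 2L, some coordinate i varies by at least L/d along xy, so one of
   the hyperplanes meets the middle third of xy, at z, and the Steiner point
   g nearest below z satisfies |xg| + |gy| <= |xy| + 3 |gz|^2 / |xy|: the
   error is quadratic in |gz|, so that a spacing of order sqrt(eps) suffices.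

   The real RAM cannot round reals, hence the net, which replaces a global
   grid, and the search for m by incrementation. *)

Require Import Defs.
From mathcomp Require Import all_boot all_order all_algebra finmap.
From mathcomp Require Import all_classical all_reals all_analysis.
From mathcomp Require Import zify ring lra.

Import Order.TTheory GRing.Theory Num.Theory.
Local Open Scope ring_scope.

Set Implicit Arguments.
Unset Strict Implicit.
Unset Printing Implicit Defensive.

Local Notation edist := Defs.edist.

(** * The program and its execution *)

Section Programs.
Variable d : nat.

Definition var (a : nat) : nexp := NGet (NLit a).

(** The machine has no integer product; a product by a factor fixed by the program is unrolled into
    additions. *)
Definition nmulk (k : nat) (e : nexp) : nexp := iter k (NAdd e) (NLit 0).

Definition block (cs : seq cmd) : cmd := foldr Seq Skip cs.

Definition for_ (v : nat) (b : nexp) (c : cmd) : cmd :=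
  Seq (NSet (NLit v) (NLit 0))
      (While (BNLt (var v) b) (Seq c (NSet (NLit v) (NAdd (var v) (NLit 1))))).

Definition band (bs : seq bexp) : bexp :=
  foldr BAnd (BNot (BNLt (NLit 0) (NLit 0))) bs.

(* Integer memory: 0 holds |T|, 1 the grid resolution m, 2 twice the number of
   edges written so far, 3 and 4 the indices of a center and of a point of T,
   5 + l the l-th grid counter, and 5 + d + i is nonzero when the i-th point is
   covered by an earlier center, i.e. is not itself a center. *)
Definition covered (v : nat) : bexp :=
  BNLt (NLit 0) (NGet (NAdd (NLit (5 + d)) (var v))).

Definition rpoint (v l : nat) : rexp :=
  RGet (NAdd (nmulk d (var v)) (NLit (l + 2))).

(** Without an absolute value, [|a - b| < r * L] is tested as two one-sided inequalities per
    coordinate. *)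
Definition rnear (r : nat) : bexp :=
  band (flatten [seq
    [:: BRLt (RSub (rpoint 3 l) (rpoint 4 l)) (RMul (RLit r) (RGet (NLit 1)));
        BRLt (RSub (rpoint 4 l) (rpoint 3 l)) (RMul (RLit r) (RGet (NLit 1)))]
    | l <- iota 0 d]).

Definition emit (f g : nat -> rexp) : cmd :=
  block ([seq ROut (f l) | l <- iota 0 d] ++ [seq ROut (g l) | l <- iota 0 d] ++
    [:: NOut (var 2); NOut (NAdd (var 2) (NLit 1));
        NSet (NLit 2) (NAdd (var 2) (NLit 2))]).

Definition resolution : cmd :=
  Seq (NSet (NLit 1) (NLit 1))
    (While (BRLt (RMul (RMul (ROfNat (var 1)) (ROfNat (var 1))) (RGet (NLit 0)))
                 (RLit 1))
      (NSet (NLit 1) (NAdd (var 1) (NLit 1)))).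

Definition net : cmd :=
  for_ 3 (var 0) (for_ 4 (var 3)
    (If (BAnd (BNot (covered 4)) (rnear 1))
      (NSet (NAdd (NLit (5 + d)) (var 3)) (NLit 1)) Skip)).

Definition rgrid (i l : nat) : rexp :=
  RAdd (RSub (rpoint 3 l) (RMul (RLit 3) (RGet (NLit 1))))
    (RDiv (RMul (ROfNat (var (5 + l))) (RGet (NLit 1)))
      (RMul (RLit (3 * d)) (if l == i then RLit 1 else ROfNat (var 1)))).

(** The grid fills the cube of side 6L around the center. Its spacing is L/(3d) along axis [i] and
    L/(3dm) along the others, hence 18d or 18dm steps, and one more point to include both faces. *)
Definition nsteps (i l : nat) : nexp :=
  NAdd (nmulk (18 * d) (if l == i then NLit 1 else var 1)) (NLit 1).

Definition nest (i : nat) (ls : seq nat) : cmd :=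
  foldr (fun l c => for_ (5 + l) (nsteps i l) c)
        (emit (rpoint 4) (rgrid i)) ls.

Definition stars : cmd :=
  for_ 3 (var 0) (If (BNot (covered 3))
    (for_ 4 (var 0) (If (rnear 3)
      (block [seq nest i (iota 0 d) | i <- iota 0 d]) Skip)) Skip).

(** The loops (x, x) written by the third phase list the points of T as vertices and weigh
    nothing. *)
Definition spanner_program : cmd :=
  block [:: resolution; net; for_ 4 (var 0) (emit (rpoint 4) (rpoint 4)); stars].

End Programs.

(** * Timed total correctness of programs *)

Section Execution.
Variable R : realType.
Implicit Types (s : state R) (c : cmd) (N B : nat) (W : seq nat).

Definition setn s (a x : nat) : state R :=
  State (upd (nmem s) a x) (rmem s) (nout s) (rout s).

Definition runs c s N (Q : state R -> Prop) : Prop :=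
  exists t s', [/\ exec c s t s', (t <= N)%N & Q s'].

Lemma runs_seq c1 c2 s N1 N2 (Q1 Q2 : state R -> Prop) :
  runs c1 s N1 Q1 -> (forall s', Q1 s' -> runs c2 s' N2 Q2) ->
  runs (Seq c1 c2) s (N1 + N2) Q2.
Proof.
move=> [t1 [s1 [e1 le1 q1]]] /(_ _ q1)[t2 [s2 [e2 le2 q2]]].
exists (t1 + t2)%N, s2; split=> //; first exact: exec_seq e1 e2.
exact: leq_add.
Qed.

Lemma runs_mono c s N N' (Q Q' : state R -> Prop) :
  runs c s N Q -> (N <= N')%N -> (forall s', Q s' -> Q' s') -> runs c s N' Q'.
Proof.
move=> [t [s' [e le q]]] leN QQ'; exists t, s'; split=> //; last exact: QQ'.
exact: leq_trans leN.
Qed.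

Lemma runs_nset a e s (Q : state R -> Prop) :
  Q (setn s (neval s a) (neval s e)) -> runs (NSet a e) s 1 Q.
Proof. by move=> q; exists 1%N, (setn s (neval s a) (neval s e)); split=> //; constructor. Qed.

(** An iteration costs at most [N + 2], for the test, the body and the increment, and two more steps
    start and end the loop. The total is below [5 * B * N] once [B] and [N] are positive. This
    product form makes nested loops multiply their bounds. *)
Lemma runs_for v b c s n N B (I : nat -> state R -> Prop) :
  I 0%N (setn s v 0) ->
  (forall k s', I k s' -> nmem s' v = k -> neval s' b = n) ->
  (forall k s', (k < n)%N -> I k s' -> nmem s' v = k ->
     runs c s' N (fun s'' => nmem s'' v = k /\ I k.+1 (setn s'' v k.+1))) ->
  (n <= B)%N -> (0 < B)%N -> (0 < N)%N ->
  runs (for_ v b c) s (5 * B * N) (I n).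
Proof.
move=> I0 Ib Istep nB B0 N0.
have loop j : forall k s', (k + j = n)%N -> I k s' -> nmem s' v = k ->
    runs (While (BNLt (var v) b) (Seq c (NSet (NLit v) (NAdd (var v) (NLit 1)))))
      s' (j * (N + 2) + 1) (I n).
  elim: j => [|j IHj] k s' kj Ik vk.
    exists 1%N, s'; split=> //; last by rewrite addn0 in kj; rewrite -kj.
    by apply: exec_while_end; rewrite /= vk (Ib k s') //; lia.
  have kn : (k < n)%N by lia.
  have [t [s1 [e1 le1 [v1 I1]]]] := Istep k s' kn Ik vk.
  have [||t2 [s2 [e2 le2 I2]]] := IHj k.+1 (setn s1 v k.+1) _ I1 _.
  - by lia.
  - by rewrite /= /upd eqxx.
  exists ((t + 1) + t2).+1, s2; split=> //; last by lia.
  apply: exec_while_step e2; first by rewrite /= vk (Ib k s').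
  apply: exec_seq e1 _.
  have -> : setn s1 v k.+1 =
      setn s1 (neval s1 (NLit v)) (neval s1 (NAdd (var v) (NLit 1))).
    by rewrite /= v1 addn1.
  exact: exec_nset.
apply: (@runs_mono _ _ (1 + (n * (N + 2) + 1)) _ (I n)) => //; last by nia.
apply: runs_seq; first by apply: runs_nset; exact: (erefl (setn s v 0)).
by move=> s' <-; apply: loop => //=; rewrite /upd eqxx.
Qed.

End Execution.

(** * Programs that append edges to the output *)

Section Emission.
Variables (R : realType) (d : nat).
Implicit Types (s : state R) (c : cmd) (N B : nat) (W : seq nat).
Implicit Types (E es : seq ('rV[R]_d * 'rV[R]_d)).

Lemma neval_ext s s' e : nmem s' = nmem s -> neval s' e = neval s e.
Proof. by move=> sn; elim: e => //= [a ->|a -> b ->|a -> b ->]; rewrite ?sn. Qed.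

Lemma reval_ext s s' e :
  nmem s' = nmem s -> rmem s' = rmem s -> reval s' e = reval s e.
Proof.
move=> sn sr; elim: e => //= [a|a|a -> b ->|a -> b ->|a -> b ->|a -> b ->] //;
  by rewrite (neval_ext _ sn) ?sr.
Qed.

(** A frame condition: only the integer cells in [W] may change, and the real memory is left as it
    was. *)
Definition agree W s s' : Prop :=
  rmem s' = rmem s /\ forall a, a \notin W -> nmem s' a = nmem s a.

Lemma agree_refl W s : agree W s s. Proof. by []. Qed.

Lemma agree_trans W s1 s2 s3 : agree W s1 s2 -> agree W s2 s3 -> agree W s1 s3.
Proof.
move=> [r12 n12] [r23 n23]; split=> [|a aW]; first by rewrite r23.
by rewrite n23 // n12.
Qed.

Lemma agree_sub W W' s s' : {subset W <= W'} -> agree W s s' -> agree W' s s'.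
Proof.
move=> WW' [r n]; split=> // a aW'; apply: n.
by apply: contra aW' => /WW'.
Qed.

Lemma agree_setn W s s' v k : v \in W -> agree W s s' -> agree W s (setn s' v k).
Proof.
move=> vW [r n]; split=> //= a aW; rewrite /upd; case: eqP => [av|_]; last exact: n.
by rewrite av vW in aW.
Qed.

(* Edge k is written as the pair of positions (2k, 2k+1), its two ends being
   freshly listed as vertices. *)
Definition outs s E : Prop :=
  [/\ nmem s 2 = (2 * size E)%N,
      nout s = flatten [seq [:: 2 * k; 2 * k + 1]%N | k <- iota 0 (size E)]
    & rout s = flatten [seq coords e.1 ++ coords e.2 | e <- E]].

(** The edges [E] written earlier are quantified inside the postcondition, so that consecutive
    emissions concatenate. *)
Definition emits W c s N es : Prop :=
  runs c s N (fun s' => agree W s s' /\ forall E, outs s E -> outs s' (E ++ es)).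

Lemma emits_block W (cf : nat -> cmd) s N F (xs : seq nat) :
  (forall x s', x \in xs -> agree W s s' -> emits W (cf x) s' N (F x)) ->
  emits W (block (map cf xs)) s (size xs * N + 1) (flatten (map F xs)).
Proof.
elim: xs s => [|x xs IH] s h /=.
  exists 1%N, s; split=> //; first exact: exec_skip.
  by split=> // E; rewrite cats0.
rewrite mulSn -addnA.
apply: (runs_seq (h x s (mem_head _ _) (agree_refl _ _))) => s' [ag out].
apply: runs_mono (IH s' _) (leqnn _) _ => [y s2 yxs ag2|s2 [ag2 out2]].
  by apply: h; [rewrite inE yxs orbT|exact: agree_trans ag2].
split; first exact: agree_trans ag2.
by move=> E /out /out2; rewrite catA.
Qed.

(** The counter [v] must lie outside [W], as the body may not disturb it, and differ from cell 2,
    which holds the next output position. *)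
Lemma emits_for W v b c s n N B F :
  v \notin W -> v != 2%N ->
  (forall s', agree (v :: W) s s' -> neval s' b = n) ->
  (forall k s', (k < n)%N -> agree (v :: W) s s' -> nmem s' v = k ->
     emits W c s' N (F k)) ->
  (n <= B)%N -> (0 < B)%N -> (0 < N)%N ->
  emits (v :: W) (for_ v b c) s (5 * B * N) (flatten [seq F k | k <- iota 0 n]).
Proof.
move=> vW v2 hb hc nB B0 N0.
have out_setn s' k E : outs s' E -> outs (setn s' v k) E.
  by case=> o1 o2 o3; split=> //=; rewrite /upd eq_sym (negbTE v2).
pose I k s' := agree (v :: W) s s' /\
  forall E, outs s E -> outs s' (E ++ flatten [seq F k | k <- iota 0 k]).
apply: (@runs_for _ v b c s n N B I) => //.
- split; first by apply: agree_setn; rewrite ?mem_head.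
  by move=> E oE; rewrite cats0; exact: out_setn.
- by move=> k s' [ag _] _; exact: hb.
- move=> k s' kn [ag out] vk.
  apply: runs_mono (hc k s' kn ag vk) (leqnn _) _ => s2 [ag2 out2].
  split; first by case: ag2 => _ ->.
  split.
    apply: agree_setn; first exact: mem_head.
    apply: agree_trans ag _; apply: agree_sub ag2 => a aW.
    by rewrite inE aW orbT.
  have -> : iota 0 k.+1 = iota 0 k ++ [:: k] by rewrite -addn1 iotaD.
  by move=> E /out /out2 /out_setn; rewrite map_cat flatten_cat /= cats0 catA.
Qed.

Lemma emits_if W b c s N es :
  (0 < N)%N -> (beval s b -> emits W c s N es) ->
  emits W (If b c Skip) s N.+1 (if beval s b then es else [::]).
Proof.
move=> N0 h; case bs: (beval s b).
  have [t [s' [e le q]]] := h bs.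
  by exists t.+1, s'; split=> //; apply: exec_if; rewrite bs.
exists 2%N, s; split=> //; last by split=> // E; rewrite cats0.
by apply: exec_if; rewrite bs; exact: exec_skip.
Qed.

(** Expressions do not read the output, so every value can be computed in the initial state. *)
Lemma runs_routs (f : nat -> rexp) ls s cs N Q :
  runs (block cs)
    (State (nmem s) (rmem s) (nout s) (rout s ++ [seq reval s (f l) | l <- ls])) N Q ->
  runs (block ([seq ROut (f l) | l <- ls] ++ cs)) s (size ls + N) Q.
Proof.
elim: ls s => [|l ls IH] s /=; first by rewrite cats0; case: s.
move=> h; rewrite -add1n -addnA.
pose s1 := State (nmem s) (rmem s) (nout s) (rcons (rout s) (reval s (f l))).
apply: (@runs_seq _ _ _ _ _ _ (eq s1)).
  by exists 1%N, s1; split=> //; exact: exec_rout.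
move=> _ <-; apply: IH => /=; rewrite cat_rcons.
by under eq_map => k do rewrite (reval_ext _ (erefl : nmem s1 = nmem s) erefl).
Qed.

Lemma coords_row (f : nat -> R) :
  coords (\row_(l < d) f l) = [seq f l | l <- iota 0 d].
Proof.
rewrite /coords -val_enum_ord -map_comp.
by apply: eq_map => l /=; rewrite mxE.
Qed.

Lemma emits_emit (f g : nat -> rexp) s :
  emits [:: 2%N] (emit d f g) s (2 * d + 4)
    [:: (\row_(l < d) reval s (f l), \row_(l < d) reval s (g l))].
Proof.
rewrite /emits /emit (_ : (2 * d + 4 = size (iota 0 d) + (size (iota 0 d) + 4))%N);
  last by rewrite size_iota; lia.
apply: runs_routs; apply: runs_routs => /=.
set ro := rout s ++ _.
have revalE no' ro' e : reval (State (nmem s) (rmem s) no' ro') e = reval s e.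
  exact: reval_ext.
under eq_map => l do rewrite revalE.
set n2 := rcons (rcons (nout s) (nmem s 2)) (nmem s 2 + 1)%N.
pose s3 := State (upd (nmem s) 2 (nmem s 2 + 2)%N) (rmem s) n2
  (ro ++ [seq reval s (g l) | l <- iota 0 d]).
exists 4%N, s3; split=> //.
  rewrite (_ : 4%N = (1 + (1 + (1 + 1)))%N) //.
  apply: exec_seq; first exact: exec_nout.
  apply: exec_seq; first exact: exec_nout.
  apply: exec_seq; last exact: exec_skip.
  exact: exec_nset.
split; first by split=> //= a; rewrite inE /upd => /negbTE ->.
move=> E [ o1 o2 o3]; split.
- by rewrite /= /upd eqxx o1 size_cat /=; lia.
- rewrite /= /n2 o2 o1 size_cat iotaD map_cat flatten_cat /= add0n.
  by rewrite -!cats1 -catA.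
- by rewrite /= /ro o3 map_cat flatten_cat /= cats0 -!catA
    (coords_row (fun l => reval s (f l))) (coords_row (fun l => reval s (g l))).
Qed.

End Emission.

(** * Correctness of the program *)

Section Construction.
Variables (R : realType) (d : nat).

Definition near_sup (r : R) (x y : 'rV[R]_d) : bool :=
  [forall l, `|x ord0 l - y ord0 l| < r].

Definition grid_point (L : R) (m i : nat) (c : 'rV[R]_d) (h : nat -> nat) : 'rV[R]_d :=
  \row_(l < d) (c ord0 l - 3 * L +
    (h l)%:R * L / ((3 * d)%:R * (if l == i :> nat then 1 else m%:R))).

Definition grid_steps (m i l : nat) : nat := (18 * d * (if l == i then 1 else m) + 1)%N.

(** The counter vectors met by nested loops over [ls], in order of execution; [h] supplies the other
    counters. *)
Fixpoint sweep (b : nat -> nat) (ls : seq nat) (h : nat -> nat) : seq (nat -> nat) :=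
  if ls is l :: ls' then flatten [seq sweep b ls' (upd h l k) | k <- iota 0 (b l)]
  else [:: h].

Definition star (L : R) (m : nat) (c x : 'rV[R]_d) : seq ('rV[R]_d * 'rV[R]_d) :=
  flatten [seq
    [seq (x, grid_point L m i c h) | h <- sweep (grid_steps m i) (iota 0 d) (fun=> 0%N)]
    | i <- iota 0 d].

(** The centers are the indices where [cov] vanishes: a point is covered exactly when an earlier
    center is within sup-distance L. *)
Definition greedy (L : R) (p : nat -> 'rV[R]_d) (cov : nat -> nat) (n : nat) : Prop :=
  forall i, (i < n)%N ->
    (0 < cov i)%N = has (fun j => (cov j == 0%N) && near_sup L (p i) (p j)) (iota 0 i).

Definition star_edges (L : R) (m n : nat) (p : nat -> 'rV[R]_d) (cov : nat -> nat) :=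
  flatten [seq if cov c == 0%N then
    flatten [seq if near_sup (3 * L) (p c) (p x) then star L m (p c) (p x) else [::]
      | x <- iota 0 n] else [::] | c <- iota 0 n].

End Construction.

Section Runs.
Variables (R : realType) (d : nat).
Implicit Types (s : state R) (N B : nat).

(** The shift by 2 skips eps and L at the start of the real memory. *)
Definition stored_point (rm : nat -> R) (i : nat) : 'rV[R]_d :=
  \row_(l < d) rm (d * i + (l + 2))%N.

Lemma neval_nmulk s k e : neval s (nmulk k e) = (k * neval s e)%N.
Proof. by elim: k => //= k ->; rewrite mulSn. Qed.

Lemma reval_rpoint s v l : reval s (rpoint d v l) = rmem s (d * nmem s v + (l + 2)).
Proof. by rewrite /= neval_nmulk. Qed.

Lemma beval_band s bs : beval s (band bs) = all (beval s) bs.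
Proof. by elim: bs => //= b bs ->. Qed.

Lemma beval_rnear s r :
  beval s (rnear d r) = near_sup (r%:R * rmem s 1)
    (stored_point (rmem s) (nmem s 3)) (stored_point (rmem s) (nmem s 4)).
Proof.
have all_flatten (T : Type) (a : pred T) ss : all a (flatten ss) = all (all a) ss.
  by elim: ss => //= t ss IH; rewrite all_cat IH.
rewrite /rnear beval_band all_flatten all_map.
apply/allP/forallP => [h l|h l].
  have := h l; rewrite mem_iota ltn_ord => /(_ isT) /=.
  rewrite !neval_nmulk /= !mxE ltr_norml; lra.
rewrite mem_iota add0n => /andP[_ ld] /=.
have := h (Ordinal ld); rewrite !neval_nmulk /= !mxE ltr_norml /=; lra.
Qed.

(** Induction over the loops still to be opened, [h] recording the counters of the enclosing ones.
    Each loop contributes a factor [5 * B]. *)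
Lemma emits_nest s i ls h B :
  uniq ls -> (forall l, (grid_steps d (nmem s 1) i l <= B)%N) ->
  (forall l, (l < d)%N -> l \notin ls -> nmem s (5 + l) = h l) ->
  emits (map (addn 5) ls ++ [:: 2%N]) (nest d i ls) s ((5 * B) ^ size ls * (2 * d + 4))
    [seq (stored_point (rmem s) (nmem s 4),
          grid_point (rmem s 1) (nmem s 1) i (stored_point (rmem s) (nmem s 3)) k)
    | k <- sweep (grid_steps d (nmem s 1) i) ls h].
Proof.
elim: ls s h => [|l ls IH] s h; rewrite [size _]/= ?cons_uniq => uls hB hh.
  have := emits_emit d (rpoint d 4) (rgrid d i) s.
  rewrite expn0 mul1n; congr emits; congr [:: (_, _)]; apply/rowP => l; rewrite !mxE.
    by rewrite reval_rpoint.
  rewrite /= neval_nmulk -/(addn 5 l) hh //.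
  by case: (_ == _).
have B0 : (0 < B)%N by apply: leq_trans (hB 0%N); rewrite /grid_steps addn1.
have /andP[lls uls'] := uls.
(* The inner loops write only cell 2 and their own counters, so L, the resolution and the two point
   indices are stable. *)
have low a : (a < 5)%N -> a != 2%N -> a \notin (5 + l)%N :: map (addn 5) ls ++ [:: 2%N].
  move=> a5 a2; rewrite inE mem_cat mem_seq1 (negbTE a2) orbF negb_or.
  by apply/andP; split; [lia|apply/mapP => -[x]; lia].
rewrite expnS -mulnA [sweep _ _ _]/= map_flatten -map_comp.
apply: emits_for => //.
- rewrite mem_cat inE negb_or (mem_map (@addnI 5)) lls /=; lia.
- move=> s' [_ ag]; rewrite /= neval_nmulk /grid_steps.
  by case: (l == i) => //=; rewrite ag // low.
- move=> k s' kn [rs' ag] vk.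
  have := IH s' (upd h l k) uls'; rewrite rs' !(ag _ (low _ _ _)) //; apply=> // l' ld l'ls.
  rewrite /upd; case: eqP => [->//|/eqP l'l].
  rewrite ag ?hh //; first by rewrite inE negb_or l'l.
  rewrite inE mem_cat inE !negb_or (mem_map (@addnI 5)) l'ls andTb.
  by move: l'l; lia.
- by rewrite muln_gt0 expn_gt0; lia.
Qed.

Definition star_cells : seq nat := [:: 3; 4]%N ++ map (addn 5) (iota 0 d) ++ [:: 2%N].

Lemma emits_stars s B :
  (forall i l, (grid_steps d (nmem s 1) i l <= B)%N) -> (nmem s 0 <= B)%N ->
  emits star_cells (stars d) s
    (5 * B * (5 * B * (d * ((5 * B) ^ d * (2 * d + 4)) + 1).+1).+1)
    (star_edges (rmem s 1) (nmem s 1) (nmem s 0) (stored_point (rmem s))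
      (fun c => nmem s (5 + d + c))).
Proof.
move=> hB nB.
have B0 : (0 < B)%N by apply: leq_trans (hB 0%N 0%N); rewrite /grid_steps addn1.
set W := map (addn 5) (iota 0 d) ++ [:: 2%N].
(* The loops of a star write cell 2 and the cells 5 to d + 4; the marks of the net begin at 5 + d
   and survive. *)
have low a : (a < 5)%N || (d + 5 <= a)%N -> a != 2%N -> a \notin W.
  move=> a5 a2; rewrite mem_cat inE negb_or a2 andbT.
  by apply/mapP => -[x]; rewrite mem_iota; lia.
have ag_low s1 s2 v a : agree (v :: W) s1 s2 -> (a < 5)%N || (d + 5 <= a)%N ->
    a != 2%N -> a != v -> nmem s2 a = nmem s1 a.
  by move=> [_ ag] a5 a2 av; apply: ag; rewrite inE negb_or av low.
have ag_low2 s1 s2 a : agree [:: 3, 4 & W] s1 s2 -> (a < 3)%N || (d + 5 <= a)%N ->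
    a != 2%N -> nmem s2 a = nmem s1 a.
  by move=> [_ ag] a5 a2; apply: ag; rewrite !inE !negb_or low //; lia.
apply: (@emits_for _ d (4%N :: W)) => //.
- by rewrite inE negb_or low.
- by move=> s' ag; rewrite /= (ag_low2 _ _ 0%N ag).
move=> c s1 cn ag1 v1.
have n1 : nmem s1 0 = nmem s 0 by apply: ag_low2 ag1 _ _.
have m1 : nmem s1 1 = nmem s 1 by apply: ag_low2 ag1 _ _.
have r1 : rmem s1 = rmem s by case: ag1.
have -> : (nmem s (5 + d + c) == 0)%N = beval s1 (BNot (covered d 3)).
  by rewrite /= v1 (ag_low2 _ _ _ ag1) -?leqNgt ?leqn0 //; lia.
apply: emits_if => [|_]; first by lia.
apply: emits_for => //; first by rewrite low.
- by move=> s' ag; rewrite /= (ag_low _ _ _ 0%N ag).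
move=> x s2 xn ag2 v2.
have n2 : nmem s2 0 = nmem s 0 by rewrite -n1; apply: ag_low ag2 _ _ _.
have m2 : nmem s2 1 = nmem s 1 by rewrite -m1; apply: ag_low ag2 _ _ _.
have c2 : nmem s2 3 = c by rewrite -v1; apply: ag_low ag2 _ _ _.
have r2 : rmem s2 = rmem s by case: ag2 => -> _.
have -> : near_sup (3 * rmem s 1) (stored_point (rmem s) c) (stored_point (rmem s) x) =
    beval s2 (rnear d 3) by rewrite beval_rnear c2 v2 r2.
apply: emits_if => [|_]; first by lia.
have := @emits_block R d W (fun i => nest d i (iota 0 d)) s2 ((5 * B) ^ d * (2 * d + 4)).
move=> /(_ (fun i => [seq (stored_point (rmem s) x,
   grid_point (rmem s 1) (nmem s 1) i (stored_point (rmem s) c) h)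
   | h <- sweep (grid_steps d (nmem s 1) i) (iota 0 d) (fun=> 0%N)]) (iota 0 d)).
rewrite size_iota; apply=> i s3 _ ag3.
have low3 a : (a < 5)%N || (d + 5 <= a)%N -> a != 2%N -> nmem s3 a = nmem s2 a.
  by move=> a5 a2; apply: ag3.2; exact: low.
have := @emits_nest s3 i (iota 0 d) (fun=> 0%N) B (iota_uniq _ _).
rewrite size_iota ag3.1 r2 !low3 // m2 c2 v2; apply; first exact: hB.
by move=> l ld; rewrite mem_iota ld.
Qed.

End Runs.

(** * Resolution, net and total running time *)

Section FullRun.
Variables (R : realType) (d : nat).
Implicit Types (s : state R) (N B : nat).

(** The hypotheses say that [m] is the least positive integer with m^2 eps >= 1. The loop makes m -
    1 turns of two steps each, and two steps start and end it. *)
Lemma runs_resolution s (m : nat) :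
  (0 < m)%N -> (forall k, (0 < k < m)%N -> k%:R * k%:R * rmem s 0 < 1) ->
  1 <= m%:R * m%:R * rmem s 0 ->
  runs resolution s (2 * m) (fun s' => [/\ rmem s' = rmem s, nout s' = nout s,
    rout s' = rout s, nmem s' 1 = m & forall a, a != 1%N -> nmem s' a = nmem s a]).
Proof.
move=> m0 ltm gem.
pose Q k s' := [/\ rmem s' = rmem s, nout s' = nout s,
    rout s' = rout s, nmem s' 1 = k & forall a, a != 1%N -> nmem s' a = nmem s a].
rewrite -/(Q m).
have loop j : forall k s', (0 < k)%N -> (k + j = m)%N -> Q k s' ->
  runs (While (BRLt (RMul (RMul (ROfNat (var 1)) (ROfNat (var 1))) (RGet (NLit 0)))
                 (RLit 1)) (NSet (NLit 1) (NAdd (var 1) (NLit 1))))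
    s' (2 * j + 1) (Q m).
  elim: j => [|j IH] k s' k0 kj [q1 q2 q3 q4 q5].
    exists 1%N, s'; split=> //; last by rewrite addn0 in kj; rewrite -kj.
    by apply: exec_while_end; rewrite /= q4 q1 -leNgt -(addn0 k) kj.
  have kj1 : (k.+1 + j = m)%N by lia.
  have Q1 : Q k.+1 (setn s' 1 k.+1).
    by split=> //= a a1; rewrite /upd (negbTE a1); exact: q5.
  have [t [s2 [e2 le2 Q2]]] := IH k.+1 _ (ltn0Sn k) kj1 Q1.
  exists (1 + t).+1, s2; split=> //; last by lia.
  apply: exec_while_step e2; first by rewrite /= q4 q1 ltm //; lia.
  have -> : setn s' 1 k.+1 =
      setn s' (neval s' (NLit 1)) (neval s' (NAdd (var 1) (NLit 1))).
    by rewrite /= q4 addn1.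
  exact: exec_nset.
apply: (@runs_mono _ _ _ (1 + (2 * m.-1 + 1)) _ (Q m)) => //; last by lia.
apply: runs_seq; first by apply: runs_nset; exact: (erefl (setn s 1 1)).
move=> s' <-; apply: (loop _ 1%N) => //; first by lia.
by split=> //= a a1; rewrite /upd (negbTE a1).
Qed.

Definition marks s (i : nat) : nat := nmem s (5 + d + i).

Lemma greedy_ext (L : R) p cov cov' k : (forall i, (i < k)%N -> cov' i = cov i) ->
  greedy (d := d) L p cov k -> greedy L p cov' k.
Proof.
move=> cc g i ik; rewrite cc // g //; apply: eq_in_has => j.
by rewrite mem_iota => /andP[_ ji]; rewrite cc //; lia.
Qed.

Lemma runs_net s B : (nmem s 0 <= B)%N -> (0 < B)%N -> (forall i, marks s i = 0%N) ->
  runs (net d) s (5 * B * (5 * B * 2)) (fun s' => [/\ rmem s' = rmem s, nout s' = nout s,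
    rout s' = rout s, forall a, (a < 3)%N -> nmem s' a = nmem s a
    & greedy (rmem s 1) (stored_point d (rmem s)) (marks s') (nmem s 0)]).
Proof.
move=> nB B0 cov0.
set L := rmem s 1; set p := stored_point _ (rmem s).
pose base s' := [/\ rmem s' = rmem s, nout s' = nout s,
  rout s' = rout s & forall a, (a < 3)%N -> nmem s' a = nmem s a].
(* Some center among the first [j] points is near point [i]. *)
pose hit cov i j := has (fun j => (cov j == 0%N) && near_sup L (p i) (p j)) (iota 0 j).
have base_setn s' v k : base s' -> (3 <= v)%N -> base (setn s' v k).
  case=> b1 b2 b3 b4 v3; split=> //= a a3; rewrite /upd; case: eqP => [av|_]; first lia.
  exact: b4.
have marks_setn s' v k i : (v < 5)%N -> marks (setn s' v k) i = marks s' i.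
  by move=> v5; rewrite /marks /= /upd; case: eqP => // h; lia.
(* Outer invariant: the first [k] marks are final and all later ones are still 0. *)
pose I k s' := [/\ base s', greedy L p (marks s') k &
  forall i, (k <= i)%N -> marks s' i = 0%N].
have : runs (net d) s (5 * B * (5 * B * 2)) (I (nmem s 0)); last first.
  by move=> h; apply: runs_mono h (leqnn _) _ => s' [[]].
apply: (@runs_for _ 3 (var 0) _ s (nmem s 0) (5 * B * 2) B I) => //; last by lia.
- split; first exact: base_setn.
    by move=> i; rewrite ltn0.
  by move=> i _; rewrite marks_setn.
- by move=> k s' [[_ _ _ b] _ _] _; exact: b.
move=> k s1 kn [b1 g1 z1] v1.
(* Inner invariant: the mark of [k] tells whether one of the first [j] points is a center near
   [k]. *)
pose J j s' := [/\ base s', nmem s' 3 = k, greedy L p (marks s') k,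
  (0 < marks s' k)%N = hit (marks s') k j & forall i, (k < i)%N -> marks s' i = 0%N].
have : runs (for_ 4 (var 3) (If (BAnd (BNot (covered d 4)) (rnear d 1))
      (NSet (NAdd (NLit (5 + d)) (var 3)) (NLit 1)) Skip)) s1 (5 * B * 2) (J k); last first.
  move=> h; apply: runs_mono h (leqnn _) _ => s' [b2 v2 g2 h2 z2].
  split=> //; split; first exact: base_setn.
    move=> i; rewrite ltnS leq_eqVlt => /predU1P[->|ik].
      rewrite marks_setn // h2; apply: eq_has => j; by rewrite marks_setn.
    rewrite marks_setn // g2 //; apply: eq_has => j; by rewrite marks_setn.
  by move=> i ki; rewrite marks_setn // z2.
apply: runs_for => //; last by apply: leq_trans nB; exact: ltnW.
- split=> //.
  + exact: base_setn.
  + by rewrite marks_setn // z1.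
  + by move=> i ki; rewrite marks_setn // z1 // ltnW.
- by move=> j s' [_ /= v2 _ _ _] _.
move=> j s2 jk [b2 v2 g2 h2 z2] w2.
set t := beval s2 (BAnd (BNot (covered d 4)) (rnear d 1)).
have tE : t = (marks s2 j == 0%N) && near_sup L (p k) (p j).
  have -> : t = beval s2 (BNot (covered d 4)) && beval s2 (rnear d 1) by [].
  rewrite beval_rnear v2 w2 /= w2 -leqNgt leqn0.
  by case: b2 => -> _ _ _; rewrite mul1r.
have hitS cov : hit cov k j.+1 = hit cov k j || ((cov j == 0%N) && near_sup L (p k) (p j)).
  by rewrite /hit -addn1 iotaD has_cat /= orbF.
case tv : t; last first.
  exists 2%N, s2; split=> //; first by apply: exec_if; rewrite -/t tv; exact: exec_skip.
  split=> //; split=> //.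
  + exact: base_setn.
  + have -> : hit (marks (setn s2 4 j.+1)) k j.+1 = hit (marks s2) k j.+1.
      by apply: eq_has => i; rewrite marks_setn.
    by rewrite marks_setn // hitS -tE tv orbF.
pose s3 := setn s2 (5 + d + k) 1.
have m3 i : marks s3 i = if i == k then 1%N else marks s2 i.
  by rewrite /marks /= /upd eqn_add2l.
exists 2%N, s3; split=> //.
  apply: exec_if; rewrite -/t tv.
  have -> : s3 = setn s2 (neval s2 (NAdd (NLit (5 + d)) (var 3))) (neval s2 (NLit 1)).
    by rewrite /= v2.
  exact: exec_nset.
have low a : (a < 5)%N -> nmem s3 a = nmem s2 a.
  by move=> a5; rewrite /= /upd; case: eqP => //; lia.
split; first by rewrite low.
split=> //.
- by do 2!apply: (base_setn) => //; lia.
- by apply: (greedy_ext _ g2) => i ik; rewrite marks_setn // m3; case: eqP => //; lia.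
(* Marking [k] does not affect the test, which looks only at indices up to [j], hence below [k]. *)
- have -> : hit (marks (setn s3 4 j.+1)) k j.+1 = hit (marks s2) k j.+1.
    apply: eq_in_has => i; rewrite mem_iota => /andP[_ ij].
    by rewrite marks_setn // m3; case: (i =P k) ij => // ->; lia.
  by rewrite marks_setn // m3 eqxx hitS -tE tv orbT.
- by move=> i ki; rewrite marks_setn // m3; case: eqP => [|_]; [lia|exact: z2].
Qed.

Definition spanner_edges (L : R) (m n : nat) (p : nat -> 'rV[R]_d) (cov : nat -> nat) :=
  [seq (p x, p x) | x <- iota 0 n] ++ star_edges L m n p cov.

(** At most d + 2 loops are nested, over centers, points and d grid counters, and [B] bounds the
    length of each; this gives the power d + 2. *)
Lemma runs_spanner_program s (m B : nat) :
  (0 < m)%N -> (forall k, (0 < k < m)%N -> k%:R * k%:R * rmem s 0 < 1) ->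
  1 <= m%:R * m%:R * rmem s 0 ->
  (forall i, (2 <= i)%N -> nmem s i = 0%N) -> nout s = [::] -> rout s = [::] ->
  (forall i l, (grid_steps d m i l <= B)%N) -> (nmem s 0 <= B)%N -> (m <= B)%N ->
  runs (spanner_program d) s (((d + 1) * (2 * d + 4) + 7) * (5 * B) ^ (d + 2))
    (fun s' => exists2 cov, greedy (rmem s 1) (stored_point d (rmem s)) cov (nmem s 0)
      & outs s' (spanner_edges (rmem s 1) m (nmem s 0) (stored_point d (rmem s)) cov)).
Proof.
move=> m0 ltm gem z no ro hB nB mB.
set p := stored_point d (rmem s).
pose T0 := (2 * d + 4)%N; pose X := (5 * B)%N.
pose T := (2 * m + (X * (X * 2) + (X * T0 +
  (X * (X * (d * (X ^ d * T0) + 1).+1).+1 + 1))))%N.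
have B0 : (0 < B)%N by exact: leq_trans mB.
(* All phases are compared with the dominant product [X ^ d * (X * X)]. *)
have TB : (T <= ((d + 1) * (2 * d + 4) + 7) * (5 * B) ^ (d + 2))%N.
  rewrite -/X -/T0 /T expnD; have Y0 : (0 < X ^ d)%N by rewrite expn_gt0 muln_gt0 B0.
  have mX : (2 * m <= X)%N by rewrite /X; lia.
  have X0 : (0 < X)%N by lia.
  set Y := (X ^ d)%N in Y0 *.
  have XY : (X * X <= Y * (X * X))%N by rewrite leq_pmull.
  have XX : (X <= X * X)%N by rewrite leq_pmull.
  have XT : (X * T0 <= T0 * (Y * (X * X)))%N.
    by rewrite mulnC leq_mul2l (leq_trans XX XY) orbT.
  have -> : (X ^ 2 = X * X)%N by [].
  have -> : (X * (X * (d * (Y * T0) + 1).+1).+1 =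
    d * T0 * (Y * (X * X)) + 2 * (X * X) + X)%N by ring.
  have -> : (((d + 1) * T0 + 7) * (Y * (X * X)) =
    d * T0 * (Y * (X * X)) + T0 * (Y * (X * X)) + 7 * (Y * (X * X)))%N by ring.
  by lia.
apply: runs_mono _ TB (fun=> id) => //.
apply: runs_seq (runs_resolution m0 ltm gem) _ => s1 [r1 no1 ro1 m1 f1].
have n1 : nmem s1 0 = nmem s 0 by rewrite f1.
apply: runs_seq.
  apply: (@runs_net s1 B) => //; first by rewrite n1.
  by move=> i; rewrite /marks f1 ?z //; lia.
move=> s2 [r2 no2 ro2 f2 g2].
have n2 : nmem s2 0 = nmem s 0 by rewrite f2.
have o2 : outs s2 ([::] : seq ('rV[R]_d * 'rV[R]_d)).
  by split; rewrite ?no2 ?no1 ?no ?ro2 ?ro1 ?ro // f2 // f1 // z.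
apply: runs_seq.
  apply: (@emits_for R d [:: 2%N] 4 _ _ s2 (nmem s 0) T0 B (fun x => [:: (p x, p x)])) => //;
    last by rewrite /T0; lia.
  - by move=> s' [_ ag] /=; rewrite ag.
  - move=> x s' xn [r' _] v'.
    have := emits_emit d (rpoint d 4) (rpoint d 4) s'; congr emits; congr [:: (_, _)];
    by apply/rowP => l; rewrite !mxE reval_rpoint v' r' r2 r1.
move=> s3 [[r3 f3] o3]; have {}o3 := o3 _ o2.
have n3 : nmem s3 0 = nmem s 0 by rewrite f3.
have m3 : nmem s3 1 = m by rewrite f3 // f2.
apply: runs_seq.
  by apply: (@emits_stars R d s3 B); rewrite ?n3 // m3.
move=> s4 [_ o4]; have {}o4 := o4 _ o3.
exists 1%N, s4; split=> //; first exact: exec_skip.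
exists (marks s3).
  move: g2; rewrite n1 r1; apply: greedy_ext => i _.
  by rewrite /marks f3 // !inE; lia.
move: o4; rewrite r3 r2 r1 n3 m3 /=; congr outs; congr (_ ++ _).
by elim: (iota 0 _) => //= x l ->.
Qed.

End FullRun.

(** * Geometry of the stars *)

Section Geometry.
Variables (R : realType) (d : nat).
Implicit Types x y g : 'rV[R]_d.

Lemma euclid_ge0 x y : 0 <= edist x y. Proof. exact: sqrtr_ge0. Qed.

Lemma euclid_sqr x y : edist x y ^+ 2 = \sum_(l < d) (x ord0 l - y ord0 l) ^+ 2.
Proof. by rewrite sqr_sqrtr // sumr_ge0 // => l _; exact: sqr_ge0. Qed.

Lemma euclidC x y : edist x y = edist y x.
Proof. by congr Num.sqrt; apply: eq_bigr => l _; ring. Qed.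

Lemma euclidxx x : edist x x = 0.
Proof.
by rewrite /edist big1 ?sqrtr0 // => l _; rewrite subrr expr0n.
Qed.

Lemma euclid_ge_coord x y l : `|x ord0 l - y ord0 l| <= edist x y.
Proof.
rewrite -sqrtr_sqr; apply: ler_wsqrtr.
rewrite (bigD1 l) //= lerDl sumr_ge0 // => k _; exact: sqr_ge0.
Qed.

Lemma euclid_le_sup x y (r : R) : 0 <= r ->
  (forall l, `|x ord0 l - y ord0 l| <= r) -> edist x y <= d%:R * r.
Proof.
move=> r0 h; rewrite -ler_sqr ?nnegrE ?euclid_ge0 ?mulr_ge0 // euclid_sqr.
apply: (@le_trans _ _ (\sum_(l < d) r ^+ 2)).
  by apply: ler_sum => l _; rewrite -real_normK ?num_real // ler_sqr ?nnegrE.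
rewrite sumr_const card_ord -[leLHS]mulr_natl exprMn; apply: ler_wpM2r; first exact: sqr_ge0.
by rewrite -natrX ler_nat; nia.
Qed.

(** This replaces the square root in a distance by its square: with r = tau D, it is (v - r)^2 >=
    0. *)
Lemma euclid_le_amgm x y (D tau : R) : 0 < D -> 0 < tau ->
  edist x y <= (edist x y ^+ 2 / (tau * D) + tau * D) / 2.
Proof.
move=> D0 t0; set v := edist x y; have t : 0 < tau * D by rewrite mulr_gt0.
rewrite -subr_ge0.
have -> : (v ^+ 2 / (tau * D) + tau * D) / 2 - v = (v - tau * D) ^+ 2 / (2 * (tau * D)).
  by field; rewrite !gt_eqF.
by rewrite divr_ge0 ?sqr_ge0 // mulr_ge0 // ltW.
Qed.

(* Applying 2|v| <= |v|^2/r + r to both legs, with r the length of the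
   corresponding part of the segment, the terms linear in the offset w of g
   from the segment cancel. *)
Lemma detour_le x y g (t : R) : 0 < edist x y -> 3^-1 <= t <= 1 - 3^-1 ->
  edist x g + edist g y <= edist x y +
    3 * (\sum_(l < d) (g ord0 l - (x ord0 l + t * (y ord0 l - x ord0 l))) ^+ 2)
      / edist x y.
Proof.
set D := edist x y => D0 /andP[t1 t2].
have t0 : 0 < t by lra.
have t0' : 0 < 1 - t by lra.
set W := \sum_(l < d) _.
have W0 : 0 <= W by apply: sumr_ge0 => l _; exact: sqr_ge0.
pose w l := g ord0 l - (x ord0 l + t * (y ord0 l - x ord0 l)).
pose X := \sum_(l < d) (y ord0 l - x ord0 l) * w l.
have DE : D ^+ 2 = \sum_(l < d) (y ord0 l - x ord0 l) ^+ 2.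
  by rewrite euclid_sqr; apply: eq_bigr => l _; ring.
have E1 : edist x g ^+ 2 = t ^+ 2 * D ^+ 2 + 2 * t * X + W.
  rewrite DE euclid_sqr !mulr_sumr -!big_split /=.
  by apply: eq_bigr => l _; rewrite /w; ring.
have E2 : edist g y ^+ 2 = (1 - t) ^+ 2 * D ^+ 2 - 2 * (1 - t) * X + W.
  rewrite DE euclid_sqr !mulr_sumr -sumrN -!big_split /=.
  by apply: eq_bigr => l _; rewrite /w; ring.
have h1 := euclid_le_amgm x g D0 t0.
have h2 := euclid_le_amgm g y D0 t0'.
rewrite E1 in h1; rewrite E2 in h2.
apply: le_trans (lerD h1 h2) _.
have -> : ((t ^+ 2 * D ^+ 2 + 2 * t * X + W) / (t * D) + t * D) / 2 +
    (((1 - t) ^+ 2 * D ^+ 2 - 2 * (1 - t) * X + W) / ((1 - t) * D) + (1 - t) * D) / 2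
    = D + W / D * (t^-1 + (1 - t)^-1) / 2.
  by field; rewrite !gt_eqF.
rewrite lerD2l -[3 * W / D]mulrA.
(* Each inverse is at most 3, so half their sum is at most 3, the constant of the statement. *)
have i1 : t^-1 <= 3 by rewrite -[3]invrK lef_pV2 ?posrE.
have i2 : (1 - t)^-1 <= 3 by rewrite -[3]invrK lef_pV2 ?posrE //; lra.
have : 0 <= W / D by rewrite divr_ge0 // ltW.
nra.
Qed.

(** Otherwise the squared distance would be less than d (L/d)^2 = L^2/d <= L^2. *)
Lemma euclid_coord_ge x y (L : R) : 0 < L -> L <= edist x y ->
  exists i, L / d%:R <= `|x ord0 i - y ord0 i|.
Proof.
move=> L0 Lxy; case: (pselect (exists i, L / d%:R <= `|x ord0 i - y ord0 i|)) => //.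
move=> /forallNP h; exfalso.
have d0 : (0 < d)%N.
  rewrite lt0n; apply/eqP => d0; move: Lxy; rewrite /edist big1 ?sqrtr0; first lra.
  by move=> i; exfalso; have := ltn_ord i; lia.
have : edist x y ^+ 2 < L ^+ 2.
  rewrite euclid_sqr.
  apply: (@lt_le_trans _ _ (\sum_(l < d) (L / d%:R) ^+ 2)).
    apply: ltr_sum; first by apply/hasP; exists (Ordinal d0); rewrite ?mem_index_enum.
    move=> l _; have /negP := h l; rewrite -ltNge => hl.
    by rewrite -real_normK ?num_real // ltr_sqr ?nnegrE // divr_ge0 // ltW.
  rewrite sumr_const card_ord -[leLHS]mulr_natl.
  have dR : 1 <= d%:R :> R by rewrite ler1n.
  have -> : d%:R * (L / d%:R) ^+ 2 = L ^+ 2 / d%:R by field; lra.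
  by rewrite ler_pdivrMr ?ler_peMr ?sqr_ge0 //; lra.
by rewrite ltr_sqr ?nnegrE ?euclid_ge0 ?(ltW L0) // ltNge Lxy.
Qed.

End Geometry.

(** * Enumeration of the grid counters *)

Lemma sumn_map_const (T : Type) (s : seq T) (a : nat) :
  sumn [seq a | _ <- s] = (size s * a)%N.
Proof. by elim: s => //= x s ->; rewrite mulSn. Qed.

Section Sweep.
Variables (T : eqType) (F : (nat -> nat) -> T) (b : nat -> nat).

Lemma size_sweep ls h : size (sweep b ls h) = (\prod_(l <- ls) b l)%N.
Proof.
elim: ls h => [|l ls IH] h; first by rewrite big_nil.
rewrite big_cons /= size_flatten /shape -map_comp.
rewrite (eq_map (g := fun=> (\prod_(l <- ls) b l)%N)) => [|k]; last exact: IH.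
by rewrite sumn_map_const size_iota.
Qed.

(** Counter vectors are functions on all naturals; since [F] reads only the first [d] values,
    agreement there is enough. *)
Lemma mem_sweep d ls h k :
  (forall h h', (forall l, (l < d)%N -> h l = h' l) -> F h = F h') ->
  (forall l, l \in ls -> (k l < b l)%N) ->
  (forall l, (l < d)%N -> l \notin ls -> h l = k l) ->
  F k \in map F (sweep b ls h).
Proof.
move=> Fext; elim: ls h => [|l ls IH] h kb hk /=.
  by rewrite mem_seq1; apply/eqP/Fext => l ld; rewrite hk.
rewrite map_flatten -map_comp; apply/flatten_mapP; exists (k l).
  by rewrite mem_iota kb ?mem_head.
apply: IH => [l' l'ls|l' ld l'ls]; first by rewrite kb // inE l'ls orbT.
by rewrite /upd; case: eqP => [->//|/eqP l'l]; rewrite hk // inE negb_or l'l.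
Qed.

Lemma sweepP ls h x : x \in map F (sweep b ls h) ->
  exists2 k, (forall l, l \in ls -> (k l < b l)%N) & x = F k.
Proof.
(* The induction also needs that counters outside [ls] keep the values of [h]. *)
suff : x \in map F (sweep b ls h) -> exists k,
  [/\ forall l, l \in ls -> (k l < b l)%N, forall l, l \notin ls -> k l = h l & x = F k].
  by move=> H /H[k [? _ ?]]; exists k.
elim: ls h => [|l ls IH] h /=.
  by rewrite mem_seq1 => /eqP ->; exists h.
rewrite map_flatten -map_comp => /flatten_mapP[j]; rewrite mem_iota => /andP[_ jb].
move=> /IH[k [kb kh ->]]; exists k; split=> // l'.
  rewrite inE; case: (boolP (l' \in ls)) => [/kb//|l'ls]; rewrite orbF => /eqP l'l.
  by rewrite kh // /upd l'l eqxx.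
by rewrite inE negb_or => /andP[/negbTE l'l l'ls]; rewrite kh // /upd l'l.
Qed.

End Sweep.

(** * Size, edge lengths and detours of a star *)

Section Stars.
Variables (R : realType) (d : nat) (L : R) (m : nat).
Hypotheses (L0 : 0 < L) (m0 : (0 < m)%N).
Implicit Types x y g c : 'rV[R]_d.

(** For each of the d axes there are 18d + 1 hyperplanes, each with (18dm + 1)^(d-1) grid points. *)
Definition star_size : nat := (d * ((18 * d + 1) * (18 * d * m + 1) ^ d.-1))%N.

Lemma size_star c x : size (star L m c x) = star_size.
Proof.
have sz i : i \in iota 0 d -> (\prod_(l <- iota 0 d) grid_steps d m i l =
    (18 * d + 1) * (18 * d * m + 1) ^ d.-1)%N.
  rewrite mem_iota add0n => /andP[_ id]; have -> : iota 0 d = index_iota 0 d by rewrite /index_iota subn0.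
  rewrite big_mkord (bigD1 (Ordinal id)) //= {1}/grid_steps eqxx muln1.
  congr muln; rewrite (eq_bigr (fun=> (18 * d * m + 1)%N)).
    by rewrite prod_nat_const cardC1 card_ord.
  by move=> l /negbTE il; rewrite /grid_steps -(inj_eq val_inj) /= in il *; rewrite il.
rewrite /star size_flatten /shape -map_comp.
transitivity (sumn [seq ((18 * d + 1) * (18 * d * m + 1) ^ d.-1)%N | _ <- iota 0 d]).
  by congr sumn; apply/eq_in_map => i id; rewrite /= size_map size_sweep sz.
by rewrite sumn_map_const size_iota.
Qed.

Lemma grid_denom_gt0 i (l : nat) : (0 < d)%N ->
  0 < (3 * d)%:R * (if l == i then 1 else m%:R) :> R.
Proof. by move=> d0; case: (_ == _); rewrite ?mulr1 -?natrM ltr0n; lia. Qed.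

(** Both ends lie in the cube of side 6L around [c]. *)
Lemma star_edge_le c x e : near_sup (3 * L) c x -> e \in star L m c x ->
  edist e.1 e.2 <= d%:R * (6 * L).
Proof.
move=> /forallP cx /flatten_mapP[i]; rewrite mem_iota add0n => /andP[_ id].
have d0 : (0 < d)%N by apply: leq_ltn_trans id.
move=> /sweepP[k kb ->] /=; apply: euclid_le_sup => [|l]; first by rewrite mulr_ge0 // ltW.
rewrite mxE; have := cx l; set a := c ord0 l - 3 * L.
have /(_ l) := kb; rewrite mem_iota ltn_ord => /(_ isT).
rewrite /grid_steps addn1 ltnS => kl.
set D := _ * (if _ then _ else _); have D0 : 0 < D := grid_denom_gt0 i l d0.
have h1 : (k l)%:R * L / D <= 6 * L.
  rewrite ler_pdivrMr // mulrAC ler_wpM2r ?(ltW L0) //.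
  rewrite (_ : 6 * D = (18 * d * (if l == i :> nat then 1 else m))%:R) ?ler_nat //.
  by rewrite /D; case: (_ == _); rewrite !natrM; ring.
have h0 : 0 <= (k l)%:R * L / D by apply: divr_ge0 (ltW D0); apply: mulr_ge0 (ltW L0).
rewrite ltr_norml ler_norml /a; lra.
Qed.

Lemma grid_point_ext i c (h h' : nat -> nat) : (forall l, (l < d)%N -> h l = h' l) ->
  grid_point L m i c h = grid_point L m i c h'.
Proof. by move=> hh; apply/rowP => l; rewrite !mxE hh. Qed.

Lemma mem_star (i : 'I_d) c x (K : 'I_d -> nat) (k := fun l => oapp K 0%N (insub l)) :
  (forall l, (K l < grid_steps d m i l)%N) ->
  (x, grid_point L m i c k) \in star L m c x.
Proof.
move=> Kb; apply/flatten_mapP; exists (i : nat); first by rewrite mem_iota ltn_ord.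
apply: (@mem_sweep _ (fun h => (x, grid_point L m i c h)) _ d).
- by move=> h h' /grid_point_ext ->.
- by move=> l; rewrite mem_iota add0n /k => ld; rewrite insubT /= Kb.
- by move=> l ld; rewrite mem_iota ld.
Qed.

(** The grid point is obtained by rounding down, in grid units, the point where the segment meets a
    hyperplane in its middle third. *)
Lemma exists_detour (eps : R) c x y : 0 < eps -> 1 <= m%:R * m%:R * eps ->
  near_sup (3 * L) c x -> near_sup (3 * L) c y -> L <= edist x y ->
  exists g, [/\ (x, g) \in star L m c x, (y, g) \in star L m c y, x != g, y != g
    & edist x g + edist g y <= (1 + eps) * edist x y].
Proof.
move=> eps0 me nx ny Lxy; have [i hi] := euclid_coord_ge L0 Lxy.
have d0 : (0 < d)%N by apply: leq_ltn_trans (ltn_ord i).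
wlog xy : x y nx ny Lxy hi / x ord0 i <= y ord0 i.
  move=> W; case: (leP (x ord0 i) (y ord0 i)) => [|/ltW] xy; first exact: W.
  have [||g [g1 g2 g3 g4 g5]] := W y x ny nx _ _ xy; rewrite 1?euclidC 1?distrC //.
  by exists g; split=> //; rewrite addrC [edist g y]euclidC [edist x g]euclidC.
rewrite distrC ger0_norm ?subr_ge0 // in hi.
have dR : 1 <= d%:R :> R by rewrite ler1n.
have mR : 1 <= m%:R :> R by rewrite ler1n.
pose De := y ord0 i - x ord0 i.
(* The height of the point at two thirds of the segment, in level spacings above the bottom face of
   the cube. Rounding it down loses at most L/(3d) <= [De]/3, so the level [G] stays in the middle
   third. *)
pose lv := (x ord0 i + 2 / 3 * De - (c ord0 i - 3 * L)) * (3 * d%:R) / L.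
have De0 : 0 < De by apply: lt_le_trans hi; rewrite divr_gt0 //; lra.
have /forallP/(_ i) := nx; have /forallP/(_ i) := ny; rewrite !ltr_norml => nyi nxi.
have lv0 : 0 <= lv.
  rewrite divr_ge0 ?(ltW L0) // mulr_ge0 ?mulr_ge0 //; rewrite /De in De0 *; lra.
pose G := c ord0 i - 3 * L + (Num.truncn lv)%:R * L / (3 * d%:R).
pose t := (G - x ord0 i) / De.
have q0 : 0 < L / (3 * d%:R) by rewrite divr_gt0 // mulr_gt0 //; lra.
have lvE : lv * (L / (3 * d%:R)) = x ord0 i + 2 / 3 * De - (c ord0 i - 3 * L).
  by rewrite /lv; field; rewrite !gt_eqF //; lra.
have /andP[tr1 tr2] := truncn_itv lv0.
have GE : G = c ord0 i - 3 * L + (Num.truncn lv)%:R * (L / (3 * d%:R)) by rewrite /G mulrA.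
have G1 : G <= x ord0 i + 2 / 3 * De.
  have : (Num.truncn lv)%:R * (L / (3 * d%:R)) <= lv * (L / (3 * d%:R)) by rewrite ler_pM2r.
  rewrite lvE GE; lra.
have G2 : x ord0 i + 1 / 3 * De <= G.
  have : lv * (L / (3 * d%:R)) <= (Num.truncn lv).+1%:R * (L / (3 * d%:R)).
    by rewrite ler_pM2r // ltW.
  have : L / (3 * d%:R) <= 1 / 3 * De.
    by rewrite invfM mulrCA mul1r ler_pM2l ?invr_gt0.
  rewrite lvE GE -natr1 mulrDl mul1r; lra.
have t1 : 3^-1 <= t by rewrite /t ler_pdivlMr //; lra.
have t2 : t <= 1 - 3^-1 by rewrite /t ler_pdivrMr //; lra.
pose z l := x ord0 l + t * (y ord0 l - x ord0 l).
have zi : z i = G by rewrite /z /t -/De mulfVK ?gt_eqF //; ring.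
(* The cube is convex and contains both ends of the segment. *)
have zc l : - (3 * L) < z l - c ord0 l < 3 * L.
  have /forallP/(_ l) := nx; have /forallP/(_ l) := ny; rewrite !ltr_norml /z; nra.
pose v l := (z l - (c ord0 l - 3 * L)) * ((3 * d)%:R * m%:R) / L.
pose K l := if l == i then Num.truncn lv else Num.truncn (v l).
have dm0 : 0 < (3 * d)%:R * m%:R :> R by rewrite mulr_gt0 // ltr0n ?muln_gt0.
have v0 l : 0 <= v l.
  rewrite divr_ge0 ?(ltW L0) // mulr_ge0 ?(ltW dm0) //; have := zc l; lra.
have Kb l : (K l < grid_steps d m i l)%N.
  rewrite /K /grid_steps -(inj_eq val_inj) /= addn1 ltnS -ltnS.
  case: (_ == _).
    rewrite truncn_lt_nat // -natr1 !natrM /lv ltr_pdivrMr //.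
    have : (x ord0 i + 2 / 3 * De - (c ord0 i - 3 * L)) * (3 * d%:R) <=
           6 * L * (3 * d%:R).
      rewrite ler_wpM2r ?mulr_ge0 //; rewrite /De; lra.
    lra.
  rewrite truncn_lt_nat // -natr1 !natrM /v natrM ltr_pdivrMr //.
  have : (z l - (c ord0 l - 3 * L)) * (3 * d%:R * m%:R) <= 6 * L * (3 * d%:R * m%:R).
    by rewrite ler_wpM2r ?mulr_ge0 //; have := zc l; lra.
  lra.
pose k l := oapp K 0%N (insub l).
pose g := grid_point L m i c k.
have kE (l : 'I_d) : k l = K l by rewrite /k valK.
have gi : g ord0 i = G by rewrite mxE kE /K !eqxx /G mulr1 natrM.
(* The rounding is exact along axis [i] and off by at most one spacing along the others. *)
have gz l : (g ord0 l - z l) ^+ 2 <= (L / (3 * d%:R * m%:R)) ^+ 2.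
  have [->|li] := eqVneq l i.
    by rewrite gi zi subrr expr0n sqr_ge0.
  have li' : (l == i :> nat) = false by exact: negbTE.
  rewrite mxE kE /K (negbTE li) li'.
  have /andP[] := truncn_itv (v0 l); rewrite -natr1; set T := (Num.truncn (v l))%:R.
  set q := L / (3 * d%:R * m%:R); move=> T1 T2.
  have qq : 0 < q by rewrite divr_gt0 // -natrM.
  have -> : T * L / ((3 * d)%:R * m%:R) = T * q by rewrite /q natrM mulrA.
  have vq : v l * q = z l - (c ord0 l - 3 * L).
    by rewrite /v /q natrM; field; rewrite !gt_eqF //; lra.
  rewrite -real_normK ?num_real // ler_sqr ?nnegrE ?(ltW qq) // ler_norml.
  have : T * q <= v l * q by rewrite ler_pM2r.
  have : v l * q <= (T + 1) * q by rewrite ler_pM2r // ltW.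
  rewrite vq mulrDl mul1r; lra.
exists g; split.
- exact: mem_star.
- exact: mem_star.
(* The level [G] is strictly between the [i]-th coordinates of [x] and [y]; this matters because
   loops are not edges. *)
- by apply/eqP => xg; move: gi G2; rewrite -xg; lra.
- by apply/eqP => yg; move: gi G1; rewrite -yg /De; rewrite /De in De0; lra.
have D0 : 0 < edist x y by exact: lt_le_trans Lxy.
have tt : 3^-1 <= t <= 1 - 3^-1 by rewrite t1 t2.
apply: le_trans (detour_le g D0 tt) _.
rewrite [(1 + eps) * _]mulrDl mul1r lerD2l ler_pdivrMr //.
apply: (@le_trans _ _ (3 * \sum_(l < d) (L / (3 * d%:R * m%:R)) ^+ 2)).
  by rewrite ler_pM2l //; apply: ler_sum => l _; exact: gz.
rewrite sumr_const card_ord -[_ *+ d]mulr_natl.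
(* The error term is L^2/(3dm^2), at most eps L^2 since m^2 eps >= 1. *)
have -> : 3 * (d%:R * (L / (3 * d%:R * m%:R)) ^+ 2) = L ^+ 2 / (3 * d%:R * (m%:R * m%:R)).
  by field; rewrite !gt_eqF //; lra.
have LL : L ^+ 2 <= edist x y ^+ 2 by rewrite ler_sqr ?nnegrE ?euclid_ge0 // ltW.
have mm : 1 <= m%:R * m%:R :> R by rewrite mulr_ege1.
have eLL : eps * L ^+ 2 <= eps * edist x y * edist x y.
  by rewrite -[leRHS]mulrA -[edist x y * _]expr2 ler_pM2l.
apply: le_trans eLL.
rewrite ler_pdivrMr; last by rewrite !mulr_gt0 //; lra.
rewrite mulrAC ler_peMl ?sqr_ge0 //.
have : 1 <= d%:R * (m%:R * m%:R * eps) by rewrite mulr_ege1.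
lra.
Qed.

End Stars.

(** * The net and the graph *)

Section Net.
Variables (R : realType) (d : nat) (L : R) (p : nat -> 'rV[R]_d) (cov : nat -> nat) (n : nat).
Hypotheses (L0 : 0 < L) (net : greedy L p cov n).

Lemma near_supC (r : R) (x y : 'rV[R]_d) : near_sup r x y = near_sup r y x.
Proof. by apply: eq_forallb => l; rewrite distrC. Qed.

Lemma greedy_cover x : (x < n)%N ->
  exists c, [/\ (c < n)%N, cov c = 0%N & near_sup L (p c) (p x)].
Proof.
move=> xn; case: (posnP (cov x)) => [x0|].
  by exists x; split=> //; apply/forallP => l; rewrite subrr normr0.
rewrite net // => /hasP[c]; rewrite mem_iota => /andP[_ cx] /andP[/eqP c0 cnear].
by exists c; rewrite near_supC; split=> //; exact: ltn_trans xn.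
Qed.

(** The later center was left unmarked when compared with the earlier one. *)
Lemma greedy_separated c c' : (c < c')%N -> (c' < n)%N -> cov c = 0%N -> cov c' = 0%N ->
  ~~ near_sup L (p c') (p c).
Proof.
move=> cc' c'n c0 c'0; have := net c'n; rewrite c'0 => /esym/negbT/hasPn/(_ c).
by rewrite mem_iota cc' c0 eqxx; apply.
Qed.

(* Centers sharing a cell of side L of the cube of side 6L around x would be
   closer than L. *)
Lemma greedy_packing x :
  (count (fun c => (cov c == 0%N) && near_sup (3 * L) (p c) x) (iota 0 n) <= 6 ^ d)%N.
Proof.
rewrite -size_filter; set s := seq.filter _ _.
(* Coordinates relative to [x] in units of L, shifted into the interval from 0 to 6; their integer
   parts form the cell. *)
pose u c l := (p c ord0 l - x ord0 l) / L + 3.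
pose cell c : {ffun 'I_d -> 'I_6} := [ffun l => inord (Num.truncn (u c l))].
have u_itv c l : c \in s -> 0 < u c l < 6.
  rewrite mem_filter => /andP[/andP[_ /forallP/(_ l) h] _]; rewrite ltr_norml in h.
  have : - 3 < (p c ord0 l - x ord0 l) / L < 3.
    by rewrite ltr_pdivlMr // ltr_pdivrMr // mulNr.
  rewrite /u; lra.
have sep c c' : c \in s -> c' \in s -> (c < c')%N -> cell c <> cell c'.
  move=> cs c's cc' E.
  have cP a : a \in s -> (a < n)%N /\ cov a = 0%N.
    by rewrite mem_filter mem_iota => /andP[/andP[/eqP -> _] /andP[_ ?]].
  have /negP := greedy_separated cc' (cP _ c's).1 (cP _ cs).2 (cP _ c's).2; apply.
  apply/forallP => l; have /ffunP/(_ l) := E; rewrite !ffunE => /(congr1 val) /=.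
  have /andP[u1 u2] := u_itv c l cs; have /andP[v1 v2] := u_itv c' l c's.
  (* The truncations are below 6, so [inord] does not fall back on its default. *)
  rewrite !inordK; last first.
  - by rewrite truncn_lt_nat // ltW.
  - by rewrite truncn_lt_nat // ltW.
  move=> tE; have /andP[] := truncn_itv (ltW u1); have /andP[] := truncn_itv (ltW v1).
  rewrite tE -natr1; set q := (Num.truncn _)%:R => i1 i2 i3 i4.
  have uE a : p a ord0 l = x ord0 l + (u a l - 3) * L by rewrite /u; field; rewrite gt_eqF.
  rewrite !uE.
  have -> : x ord0 l + (u c' l - 3) * L - (x ord0 l + (u c l - 3) * L) =
    (u c' l - u c l) * L by ring.
  rewrite normrM (gtr0_norm L0) -[ltRHS]mul1r ltr_pM2r // ltr_norml; lra.
rewrite -(size_map cell) -[X in (_ <= X ^ _)%N](card_ord 6) -[d in (_ ^ d)%N]card_ord -card_ffun.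
have Us : uniq (map cell s).
  rewrite map_inj_in_uniq ?filter_uniq ?iota_uniq // => c c' cs c's E.
  by case: (ltngtP c c') => // h; [case: (sep _ _ cs c's h)|case: (sep _ _ c's cs h)].
by rewrite -(card_uniqP Us) max_card.
Qed.

End Net.

(** * Graphs given by edge lists *)

Section Graph.
Variables (R : realType) (d : nat).
Implicit Types (E : seq ('rV[R]_d * 'rV[R]_d)) (x y g u v : 'rV[R]_d).

Definition endpoints E : seq 'rV[R]_d := flatten [seq [:: e.1; e.2] | e <- E].

Definition edge_adj E : rel 'rV[R]_d :=
  fun u v => (u != v) && (((u, v) \in E) || ((v, u) \in E)).

Lemma mem_endpoints E u v : (u, v) \in E -> (u \in endpoints E) && (v \in endpoints E).
Proof.
by move=> uvE; apply/andP; split; apply/flatten_mapP; exists (u, v);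
  rewrite // !inE eqxx ?orbT.
Qed.

Lemma edge_adj_sym E : symmetric (edge_adj E).
Proof. by move=> u v; rewrite /edge_adj eq_sym orbC. Qed.

Lemma edge_adj_irr E : irreflexive (edge_adj E).
Proof. by move=> u; rewrite /edge_adj eqxx. Qed.

Lemma edge_adj_verts E u v : edge_adj E u v ->
  (u \in [fset w in endpoints E]%fset) && (v \in [fset w in endpoints E]%fset).
Proof.
by rewrite !inE /= => /andP[_ /orP[] /mem_endpoints]; rewrite // andbC.
Qed.

Definition edge_graph E : geom_graph R d :=
  GeomGraph (@edge_adj_sym E) (@edge_adj_irr E) (@edge_adj_verts E).

Lemma outs_edge_graph s E : outs s E -> outputs_graph s (edge_graph E).
Proof.
move=> [_ no ro].
exists (endpoints E), [seq (2 * k, 2 * k + 1)%N | k <- iota 0 (size E)].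
have size_ends F : size (endpoints F) = (2 * size F)%N by elim: F => //= e F ->; lia.
have nthE k : nth 0 (endpoints E) (2 * k) = (nth (0, 0) E k).1 /\
    nth 0 (endpoints E) (2 * k + 1) = (nth (0, 0) E k).2.
  elim: E k {no ro} => [|e F IH] k; first by rewrite !nth_nil.
  case: k => [|k] //.
  rewrite (_ : 2 * k.+1 = (2 * k).+2)%N; last by lia.
  exact: IH.
split.
- by rewrite ro; elim: (E) => //= e F ->; rewrite catA.
- by rewrite no -map_comp.
- apply/allP => e /mapP[k]; rewrite mem_iota size_ends => /andP[_ kE] -> /=; lia.
- by move=> u; rewrite /= !inE.
- move=> u v; rewrite /= /edge_adj; congr (_ && _).
  apply/idP/hasP => [|[e /mapP[k]]].
    move=> /orP[] /(nthP (0, 0))[k kE Ek]; exists (2 * k, 2 * k + 1)%N;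
      rewrite ?(map_f (fun k => (2 * k, 2 * k + 1)%N)) ?mem_iota //=;
      by rewrite !(nthE k).1 !(nthE k).2 Ek eqxx ?orbT.
  rewrite mem_iota => /andP[_ kE] -> /=; rewrite (nthE k).1 (nthE k).2 -surjective_pairing.
  by move=> /orP[] /eqP ->; rewrite mem_nth ?orbT.
Qed.

Lemma gdist_via E x g y : edge_adj E x g -> edge_adj E g y ->
  (gdist (edge_graph E) x y <= (edist x g + edist g y)%:E)%E.
Proof.
move=> xg gy; apply: ereal_inf_lbound; exists [:: g; y].
  split; first by have /andP[] := edge_adj_verts xg.
  by rewrite /= xg gy.
by rewrite /walk_length /= !big_cons big_nil addr0.
Qed.

Lemma sum_le_subset (T : eqType) (f : T -> R) (s t : seq T) :
  (forall a, 0 <= f a) -> uniq s -> {subset s <= t} ->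
  \sum_(x <- s) f x <= \sum_(x <- t) f x.
Proof.
move=> f0; elim: s t => [|x s IH] t /=; first by move=> _ _; rewrite big_nil sumr_ge0.
move=> /andP[xs us] st; have xt : x \in t by rewrite st ?mem_head.
rewrite (perm_big _ (perm_to_rem xt)) !big_cons lerD2l; apply: IH => // y ys.
apply: rem_mem; last by rewrite st // inE ys orbT.
by apply: contraNneq xs => <-.
Qed.

(** Only an inequality, as the list may repeat an edge or hold both orientations. The double sum is
    split by orientation into two sums, each at most the weight of the list; halving compensates. *)
Lemma gweight_le E : gweight (edge_graph E) <= \sum_(e <- E) edist e.1 e.2.
Proof.
rewrite /gweight ler_pdivrMr //; set V := gverts _.
have uV : uniq (V : seq _) by exact: fset_uniq.
have le_E : \sum_(u <- V) \sum_(v <- V | (u, v) \in E) edist u v <=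
    \sum_(e <- E) edist e.1 e.2.
  have -> : \sum_(u <- V) \sum_(v <- V | (u, v) \in E) edist u v =
      \sum_(e <- [seq e <- [seq (u, v) | u <- V, v <- V] | e \in E]) edist e.1 e.2.
    rewrite big_filter big_flatten big_map.
    by apply: eq_bigr => u _; rewrite big_map.
  apply: sum_le_subset => [e| |e]; first exact: euclid_ge0.
    by rewrite filter_uniq // allpairs_uniq // => -[a b] [a' b'] _ _ [-> ->].
  by rewrite mem_filter => /andP[].
have le_E' : \sum_(u <- V) \sum_(v <- V | (v, u) \in E) edist u v <=
    \sum_(e <- E) edist e.1 e.2.
  apply: le_trans le_E; rewrite (exchange_big_dep predT) //=.
  by apply: ler_sum => u _; apply: ler_sum => v _; rewrite euclidC.
rewrite mulr_natr mulr2n; apply: le_trans (lerD le_E le_E').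
rewrite -big_split /=; apply: ler_sum => u _.
rewrite big_mkcond [X in _ <= X + _]big_mkcond [X in _ <= _ + X]big_mkcond -big_split /=.
apply: ler_sum => v _; rewrite /edge_adj.
case: (u != v) => /=; case: ((u, v) \in E); case: ((v, u) \in E);
  rewrite /=; have := euclid_ge0 u v; lra.
Qed.

End Graph.

(** * Stretch and weight of the spanner *)

Section Spanner.
Variables (R : realType) (d : nat) (L : R) (p : nat -> 'rV[R]_d) (cov : nat -> nat) (n m : nat).
Hypotheses (L0 : 0 < L) (m0 : (0 < m)%N) (net : greedy L p cov n).

Local Notation E := (spanner_edges L m n p cov).

Lemma star_sub_edges c x e : (c < n)%N -> (x < n)%N -> cov c = 0%N ->
  near_sup (3 * L) (p c) (p x) -> e \in star L m (p c) (p x) -> e \in E.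
Proof.
move=> cn xn c0 cx eS; rewrite mem_cat; apply/orP; right.
apply/flatten_mapP; exists c; first by rewrite mem_iota.
rewrite c0 eqxx; apply/flatten_mapP; exists x; first by rewrite mem_iota.
by rewrite cx.
Qed.

Lemma vertices_edges x : (x < n)%N -> p x \in gverts (edge_graph E).
Proof.
move=> xn; rewrite !inE; suff /mem_endpoints/andP[] : (p x, p x) \in E by [].
by rewrite mem_cat; apply/orP; left; apply/mapP; exists x; rewrite ?mem_iota.
Qed.

Lemma stretch_edges (eps : R) x y : 0 < eps -> 1 <= m%:R * m%:R * eps ->
  (x < n)%N -> (y < n)%N -> L <= edist (p x) (p y) <= 2 * L ->
  (gdist (edge_graph E) (p x) (p y) <= ((1 + eps) * edist (p x) (p y))%:E)%E.
Proof.
move=> eps0 me xn yn /andP[xy1 xy2].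
have [c [cn c0 /forallP cx]] := greedy_cover L0 net xn.
have nx : near_sup (3 * L) (p c) (p x).
  by apply/forallP => l; apply: lt_le_trans (cx l) _; lra.
(* The center covering [x] is within L of it, and [y] is within 2L of [x]: this is why stars reach
   to distance 3L. *)
have ny : near_sup (3 * L) (p c) (p y).
  apply/forallP => l; have := cx l; have := euclid_ge_coord (p x) (p y) l.
  rewrite !ltr_norml ler_norml; lra.
have [g [xg yg xNg yNg le_g]] := exists_detour L0 m0 eps0 me nx ny xy1.
have {}xg := star_sub_edges cn xn c0 nx xg.
have {}yg := star_sub_edges cn yn c0 ny yg.
apply: le_trans (@gdist_via _ _ E (p x) g (p y) _ _) _.
- by rewrite /edge_adj xNg xg.
- by rewrite /edge_adj eq_sym yNg yg orbT.
- by rewrite lee_fin.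
Qed.

Lemma weight_star (c x : 'rV[R]_d) : near_sup (3 * L) c x ->
  \sum_(e <- star L m c x) edist e.1 e.2 <= (star_size d m)%:R * (d%:R * (6 * L)).
Proof.
move=> cx; rewrite -(size_star L m c x) mulr_natl -iter_addr_0 -count_predT -big_const_seq.
by rewrite big_seq [leRHS]big_seq; apply: ler_sum => e; exact: star_edge_le.
Qed.

Lemma weight_edges : \sum_(e <- E) edist e.1 e.2 <=
  n%:R * ((6 ^ d)%:R * ((star_size d m)%:R * (d%:R * (6 * L)))).
Proof.
set W := (star_size d m)%:R * _.
have W0 : 0 <= W by rewrite !mulr_ge0 // ltW.
rewrite big_cat big_map /= big1 ?add0r => [|x _]; last exact: euclidxx.
pose b c x := (cov c == 0%N) && near_sup (3 * L) (p c) (p x).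
apply: (@le_trans _ _ (\sum_(c <- iota 0 n) \sum_(x <- iota 0 n) (b c x)%:R * W)).
  rewrite /star_edges big_flatten big_map; apply: ler_sum => c _.
  case: eqP => c0; last by rewrite big_nil sumr_ge0 // => x _; rewrite mulr_ge0.
  rewrite big_flatten big_map; apply: ler_sum => x _; rewrite /b c0 eqxx /=.
  by case: ifP => [/weight_star|_]; rewrite ?mul1r // big_nil mulr_ge0.
(* Summing over points first, each point meets at most 6^d stars by packing. *)
rewrite exchange_big /=.
have -> : n%:R * ((6 ^ d)%:R * W) = \sum_(x <- iota 0 n) (6 ^ d)%:R * W.
  by rewrite big_const_seq count_predT size_iota iter_addr_0 mulr_natl.
apply: ler_sum => x _; rewrite -mulr_suml ler_wpM2r // -natr_sum ler_nat.
apply: leq_trans (greedy_packing L0 net (p x)).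
by rewrite -sum1_count [leqRHS]big_mkcond; apply: leq_sum => c _; rewrite /b; case: ifP.
Qed.

End Spanner.

(** * The resolution, numerical bounds and the oracle *)

(** By minimality (m - 1)^2 < 1/eps, and m >= 2 because eps < 1, so m <= 2(m - 1). The bound by
    1/eps serves the running time, the bound by eps^(-1/2) the weight. *)
Lemma exists_resolution (R : realType) (eps : R) : 0 < eps < 1 ->
  exists m : nat, [/\ (0 < m)%N, forall k, (0 < k < m)%N -> k%:R * k%:R * eps < 1,
    1 <= m%:R * m%:R * eps, m%:R <= 2 * eps^-1 & m%:R <= 2 * eps `^ (- 2^-1)].
Proof.
move=> /andP[e0 e1]; pose P m := (0 < m)%N && (1 <= m%:R * m%:R * eps).
have exP : exists m, P m.
  (* Any integer M >= 1 with M eps >= 1 also satisfies M^2 eps >= 1. *)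
  exists (Num.truncn eps^-1).+1; rewrite /P /=.
  have ei : 0 <= eps^-1 by rewrite invr_ge0 ltW.
  have : eps^-1 <= (Num.truncn eps^-1).+1%:R by have /andP[_ /ltW] := truncn_itv ei.
  set M := _.+1%:R => h; have M1 : 1 <= M by rewrite /M ler1n.
  have : 1 <= M * eps by rewrite -ler_pdivrMr // div1r.
  rewrite -mulrA; move: (M * eps) => q; nra.
case: (ex_minnP exP) => m /andP[m0 me] mmin; exists m.
have ltm k : (0 < k < m)%N -> k%:R * k%:R * eps < 1.
  move=> /andP[k0 km]; rewrite ltNge; apply/negP => h.
  by have := mmin k; rewrite /P k0 h => /(_ isT); lia.
have m2 : (1 < m)%N.
  by rewrite ltn_neqAle m0 andbT; apply/eqP => m1; move: me; rewrite -m1; lra.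
have := ltm m.-1; have -> : (0 < m.-1 < m)%N by lia.
move=> /(_ isT); set k : R := m.-1%:R => kk.
have mk : m%:R = k + 1 :> R by rewrite natr1 prednK.
have k1 : 1 <= k by rewrite ler1n; lia.
pose q := eps `^ (- 2^-1).
have q0 : 0 < q by exact: powR_gt0.
have qq : q * q = eps^-1.
  rewrite -powRD; last by rewrite (gt_eqF e0) implybT.
  by rewrite -[RHS]powR_inv1 ?(ltW e0) //; congr (_ `^ _); lra.
have kq : k * k < q * q by rewrite qq -[ltRHS]div1r ltr_pdivlMr.
have {}kq : k <= q by nra.
split=> //; rewrite mk; last by rewrite -/q; lra.
rewrite -qq; nra.
Qed.

Lemma nth_flatten_coords (R : realType) (d : nat) (T : seq 'rV[R]_d) (r : seq R)
    i (l : 'I_d) : (i < size T)%N ->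
  nth 0 (flatten [seq coords x | x <- T] ++ r) (d * i + l) = nth 0 T i ord0 l.
Proof.
have size_coords (x : 'rV[R]_d) : size (coords x) = d by rewrite size_map size_enum_ord.
elim: T i => [|x T IH] [|i] //= iT; rewrite -catA nth_cat size_coords.
  rewrite muln0 add0n ltn_ord (nth_map l) ?size_enum_ord //.
  by rewrite nth_ord_enum.
have -> : (d * i.+1 + l < d)%N = false by lia.
by rewrite (_ : d * i.+1 + l - d = d * i + l)%N ?IH //; lia.
Qed.

Lemma stored_point_init (R : realType) (d : nat) (eps L : R) (P T : seq 'rV[R]_d) i :
  (i < size T)%N -> stored_point d (rmem (init_state eps P T L)) i = nth 0 T i.
Proof.
move=> iT; apply/rowP => l; rewrite mxE /= addn2 addnS /= addnS /=.
by rewrite nth_flatten_coords.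
Qed.

Lemma time_bound (R : realType) (eps : R) (d m n : nat) :
  0 < eps < 1 -> m%:R <= 2 * eps^-1 ->
  ((((d + 1) * (2 * d + 4) + 7) * (5 * (18 * d * m + 1 + n)) ^ (d + 2))%N)%:R <=
  ((((d + 1) * (2 * d + 4) + 7) * (5 * (36 * d + 1)) ^ (d + 2))%N)%:R *
    (n%:R + eps^-1) ^+ (d + 2).
Proof.
move=> /andP[e0 e1] me; rewrite !natrM -mulrA ler_wpM2l // !natrX !natrM -exprMn.
rewrite lerXn2r ?nnegrE //.
  by rewrite mulr_ge0 // addr_ge0 // invr_ge0 ltW.
rewrite -mulrA ler_wpM2l // !natrD !natrM.
have i1 : 1 <= eps^-1 by rewrite invf_ge1 // ltW.
have := ler0n R d; have := ler0n R n; set D := d%:R; set N := n%:R => N0 D0.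
have : D * m%:R <= D * (2 * eps^-1) by rewrite ler_wpM2l.
have : 0 <= D * N by rewrite mulr_ge0.
nra.
Qed.

(** Since 18dm + 1 <= 19dm and m <= 2 eps^(-1/2), each of the d - 1 factors is at most 38d
    eps^(-1/2). *)
Lemma star_size_bound (R : realType) (eps : R) (d m : nat) :
  0 < eps -> (0 < d)%N -> (0 < m)%N -> m%:R <= 2 * eps `^ (- 2^-1) ->
  (star_size d m)%:R <=
  (d * (18 * d + 1) * (38 * d) ^ d.-1)%N%:R * eps `^ (- ((d%:R - 1) / 2)).
Proof.
move=> e0 d0 m0 me.
apply: (@le_trans _ _ ((d * (18 * d + 1) * (19 * d * m) ^ d.-1)%N%:R)).
  rewrite ler_nat /star_size mulnA leq_mul2l; apply/orP; right.
  by case: (posnP d.-1) => [->//|k0]; rewrite leq_exp2r //; nia.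
rewrite ![(_ * _ ^ _)%N%:R]natrM -[leRHS]mulrA ler_wpM2l //.
have -> : eps `^ (- ((d%:R - 1) / 2)) = (eps `^ (- 2^-1)) ^+ d.-1.
  rewrite -powR_mulrn ?powR_ge0 // -powRrM; congr (_ `^ _).
  by rewrite -[in LHS](prednK d0) -natr1; lra.
rewrite !natrX -exprMn lerXn2r ?nnegrE ?mulr_ge0 ?powR_ge0 //.
rewrite !natrM; have := ler0n R d; nra.
Qed.

Theorem theorem1p16 (R : realType) (d : nat) (d_gt0 : (0 < d)%N) :
  exists (A : cmd) (a b k : nat) (C : R),
    0 < C /\
    forall (eps : R), 0 < eps < 1 ->
    forall (P : seq 'rV[R]_d), uniq P ->
    exists O : oracle R d,
      [/\ computes_oracle A a b eps P O,
          spanner_oracle eps P O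
        & (weak_sparsity P O <=
           (C * eps `^ (- ((d%:R - 1) / 2)) * (1 + ln (eps^-1)) ^+ k)%:E)%E].
Proof.
pose c0 := (d * (18 * d + 1) * (38 * d) ^ d.-1)%N.
(* No logarithmic factor arises, so its exponent is 0. The weight constant multiplies 6^d stars per
   point, the constant [c0] of the star size and the edge length bound 6d. *)
exists (spanner_program d), (((d + 1) * (2 * d + 4) + 7) * (5 * (36 * d + 1)) ^ (d + 2))%N,
  (d + 2)%N, 0%N, (6 ^ d * c0 * (6 * d))%N%:R.
split; first by rewrite ltr0n !muln_gt0 !expn_gt0 muln_gt0 d_gt0 addn1.
move=> eps eps01 P _; have /andP[e0 e1] := eps01.
have [m [m0 ltm gem me me2]] := exists_resolution eps01.
pose w := 6 * d%:R * ((6 ^ d)%:R * (c0%:R * eps `^ (- ((d%:R - 1) / 2)))).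
(* All guarantees are gathered for one query, seen as a pair, so that a choice function yields the
   oracle. Pairs that are not queries receive the empty graph. *)
have answer (q : seq 'rV[R]_d * R) : exists S : geom_graph R d, query P q.1 q.2 ->
    [/\ exists t s, [/\ exec (spanner_program d) (init_state eps P q.1 q.2) t s,
          t%:R <= (((d + 1) * (2 * d + 4) + 7) * (5 * (36 * d + 1)) ^ (d + 2))%N%:R *
            ((size q.1)%:R + eps^-1) ^+ (d + 2)
          & outputs_graph s S],
        {subset q.1 <= gverts S},
        forall x y, x \in q.1 -> y \in q.1 -> q.2 <= edist x y <= 2 * q.2 ->
          (gdist S x y <= ((1 + eps) * edist x y)%:E)%E
      & gweight S <= (size q.1)%:R * q.2 * w].
  case: q => T L /=; case: (pselect (query P T L)) => [[_ _ L0]|nq]; last first.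
    by exists (edge_graph [::]).
  pose s0 := init_state eps P T L; pose n := size T.
  have z i : (2 <= i)%N -> nmem s0 i = 0%N by case: i => [|[|[|i]]].
  (* The common loop bound [B] is taken to be 18dm + 1 + n, which dominates the grid counters, |T|
     and [m]. *)
  have hB i l : (grid_steps d m i l <= 18 * d * m + 1 + n)%N.
    by rewrite /grid_steps; case: (l == i); nia.
  have nB : (nmem s0 0 <= 18 * d * m + 1 + n)%N by rewrite leq_addl.
  have mB : (m <= 18 * d * m + 1 + n)%N by nia.
  have [t [s [run tB [cov net out]]]] :=
    runs_spanner_program (s := s0) m0 ltm gem z erefl erefl hB nB mB.
  set p := stored_point d (rmem s0) in net out.
  have pT x : x \in T -> exists2 i, (i < n)%N & x = p i.
    move=> xT; exists (index x T); first by rewrite index_mem.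
    by rewrite /p stored_point_init ?index_mem // nth_index.
  exists (edge_graph (spanner_edges L m n p cov)) => _; split.
  - exists t, s; split=> //; last exact: outs_edge_graph.
    by apply: le_trans (time_bound d n eps01 me); rewrite ler_nat.
  - by move=> x /pT[i iN ->]; exact: vertices_edges.
  - move=> x y /pT[i iN ->] /pT[j jN ->] ij; exact: stretch_edges net _ _ _ _ _ _ _ ij.
  - apply: le_trans (gweight_le _) _; apply: le_trans (weight_edges L0 m0 net) _.
    have h := star_size_bound e0 d_gt0 m0 me2.
    rewrite -mulrA ler_wpM2l // /w.
    have -> : L * (6 * d%:R * ((6 ^ d)%:R * (c0%:R * eps `^ (- ((d%:R - 1) / 2))))) =
      (6 ^ d)%:R * ((c0%:R * eps `^ (- ((d%:R - 1) / 2))) * (d%:R * (6 * L))) by ring.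
    by rewrite ler_wpM2l // ler_wpM2r // !mulr_ge0 // ltW.
have [ora oraP] := choice answer.
exists (fun T L => ora (T, L)); split.
- by move=> T L q; have [] := oraP (T, L) q.
- move=> T L q; have [_ TV str _] := oraP (T, L) q; split=> // x y xT yT _.
  exact: str.
- apply: ge_ereal_sup => _ [T [L [q T0 ->]]]; have [_ _ _ /= gw] := oraP (T, L) q.
  have L0 : 0 < L by case: q.
  rewrite lee_fin expr0 mulr1 ler_pdivrMr; last first.
    by rewrite mulr_gt0 // ltr0n lt0n size_eq0.
  apply: le_trans gw _; rewrite mulrC ler_wpM2r //.
    by rewrite mulr_ge0 // ltW.
  by rewrite le_eqVlt; apply/predU1P; left; rewrite /w !natrM; ring.
Qed.
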